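(* Let $N\ge 1$ and $r\ge 1$ be integers and consider the coupled system $$\dot{\mathbf{x}}^i_j=\bar f^i_j(\mathbf{x}^i_1,\dots,\mathbf{x}^i_{j+1})+\Delta^i_j(\mathbf{x}),\quad j=1,\dots,r-1,\qquad \dot{\mathbf{x}}^i_r=\bar f^i_r(\mathbf{x}^i_1,\dots,\mathbf{x}^i_r,\mathbf{u}^i)+\Delta^i_r(\mathbf{x}),$$ for $i=1,\dots,N$, where the uncoupled dynamics are regular at the operating point $(\mathbf{x}^*,\mathbf{u}^* )$ (see context). Suppose that on a neighborhood of $(\mathbf{x}^*,\mathbf{u}^* )$ the coupling $\Delta$ is lower-triangular. Then there is an open neighborhood $\mathcal{X}$ of $(\mathbf{x}^*,\mathbf{u}^* )$ on which the joint system is differentially flat, and a flat output is $\mathbf{y}=(\mathbf{x}^1_1,\mathbf{x}^2_1,\dots,\mathbf{x}^N_1)$, i.e. the concatenation of the first-order substates of all subsystems.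
   Context: Setup. There are $N$ subsystems. Subsystem $i$ has input $\mathbf{u}^i\in\mathbb{R}^{m_i}$ and state $\mathbf{x}^i=(\mathbf{x}^i_1,\dots,\mathbf{x}^i_r)\in\mathbb{R}^{rm_i}$ with $\mathbf{x}^i_j\in\mathbb{R}^{m_i}$. The joint state is $\mathbf{x}=(\mathbf{x}^1,\dots,\mathbf{x}^N)$ and the joint input is $\mathbf{u}=(\mathbf{u}^1,\dots,\mathbf{u}^N)$. Write $\mathbf{x}_j=(\mathbf{x}^1_j,\dots,\mathbf{x}^N_j)$ for the $j$-th order substates of all subsystems, $\mathbf{x}_{\le j}=(\mathbf{x}_1,\dots,\mathbf{x}_j)$, and $\mathbf{x}^{<i}_{j+1}=(\mathbf{x}^1_{j+1},\dots,\mathbf{x}^{i-1}_{j+1})$, which is empty when $i=1$. The uncoupled dynamics $\bar f^i=(\bar f^i_1,\dots,\bar f^i_r)$ are in pure-feedback form as displayed in the claim, with $\Delta\equiv 0$. Regularity (Assumption 1). Each $\bar f^i_j$ is smooth on a neighborhood of the operating point $(\mathbf{x}^*,\mathbf{u}^* )$. At the operating point, $\det D_{\mathbf{x}^i_{j+1}}\bar f^i_j\neq 0$ for $j=1,\dots,r-1$, and $\det D_{\mathbf{u}^i}\bar f^i_r\neq 0$. Lower-triangular coupling on a set $\mathcal{X}$. Each $\Delta^i_j$ is smooth, and there are functions $\bar\Delta^i_j$ such that $\Delta^i_j(\mathbf{x})=\bar\Delta^i_j(\mathbf{x}_{\le j},\mathbf{x}^{<i}_{j+1})$ for all $(\mathbf{x},\mathbf{u})\in\mathcal{X}$.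 In words, $\Delta^i_j$ depends only on substates of order at most $j$ of all subsystems, and on substates of order $j+1$ of subsystems with index smaller than $i$. Differential flatness. A system $\dot{\mathbf{x}}=f(\mathbf{x},\mathbf{u})$ is differentially flat with flat output $\mathbf{y}$ if two conditions hold. First, $\mathbf{y}$ is a smooth function of $\mathbf{x}$, $\mathbf{u}$ and finitely many derivatives of $\mathbf{u}$. Second, there exist smooth maps $\Phi,\Psi$ and an integer $\beta$ such that, along trajectories, $\mathbf{x}=\Phi(\mathbf{y},\dot{\mathbf{y}},\dots,\mathbf{y}^{(\beta)})$ and $\mathbf{u}=\Psi(\mathbf{y},\dot{\mathbf{y}},\dots,\mathbf{y}^{(\beta)})$. *)

(* Defs.v *)
From Stdlib Require Import Reals ClassicalEpsilon.
From Coquelicot Require Import Coquelicot.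
From mathcomp Require Import all_boot all_algebra.
From mathcomp Require Import Rstruct.

Unset Printing Implicit Defensive.

Local Open Scope R_scope.

Definition upd {I : eqType} (p : I -> R) (c : I) (t : R) : I -> R :=
  fun c' => if c' == c then p c' + t else p c'.

Definition pd {I : eqType} (F : (I -> R) -> R) (p : I -> R) (c : I) : R :=
  Derive (fun t => F (upd p c t)) 0.

Definition near_pt {I : eqType} (p q : I -> R) (e : R) : Prop :=
  forall c, Rabs (q c - p c) < e.

Definition is_open {I : eqType} (U : (I -> R) -> Prop) : Prop :=
  forall p, U p -> exists e, 0 < e /\ forall q, near_pt p q e -> U q.

Definition cont_on {I : eqType} (U : (I -> R) -> Prop) (F : (I -> R) -> R) : Prop :=
  forall p, U p -> forall e, 0 < e ->
    exists d, 0 < d /\ forall q, U q -> near_pt p q d -> Rabs (F q - F p) < e.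

Fixpoint Ck {I : eqType} (k : nat) (U : (I -> R) -> Prop) (F : (I -> R) -> R)
  : Prop :=
  match k with
  | O => cont_on U F
  | S k' => cont_on U F /\
            forall c, (forall p, U p -> ex_derive (fun t => F (upd p c t)) 0) /\
                      Ck k' U (fun p => pd F p c)
  end.

Definition smooth_on {I : eqType} (U : (I -> R) -> Prop) (F : (I -> R) -> R) : Prop :=
  forall k, Ck k U F.

Definition join {I J : eqType} (p : I -> R) (q : J -> R) : (I + J)%type -> R :=
  fun c => match c with inl a => p a | inr b => q b end.

Definition xpart {I J : eqType} (p : (I + J)%type -> R) : I -> R := fun a => p (inl a).

Definition mask {I : eqType} (P : I -> Prop) (p : I -> R) : I -> R :=
  fun c => match excluded_middle_informative (P c) with
           | left _ => p c | right _ => 0 end.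

(* joint state index: (i, (j, k)) = k-th coordinate of x^i_{j+1}
   (orders are 0-based: j : 'I_r stands for the order j+1) *)
Definition SI {N : nat} (r : nat) (m : 'I_N -> nat) : eqType :=
  {i : 'I_N & ('I_r * 'I_(m i))%type}.
(* joint input index: (i, k) = k-th coordinate of u^i *)
Definition UI {N : nat} (m : 'I_N -> nat) : eqType := {i : 'I_N & 'I_(m i)}.

Definition LI (r mi : nat) : eqType := (('I_r * 'I_mi) + 'I_mi)%type.

Definition loc {N r : nat} {m : 'I_N -> nat} (x : SI r m -> R) (u : UI m -> R)
  (i : 'I_N) : LI r (m i) -> R :=
  fun c => match c with
           | inl jk => x (existT _ i jk)
           | inr k => u (existT _ i k)
           end.
Arguments loc {N r m} x u i _.

(* joint vector field  xdot^i_j = fbar^i_j(x^i,u^i) + Delta^i_j(x).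
   fbar i p (j,k) is the k-th component of \bar f^i_{j+1} at the local point p. *)
Definition joint_field {N r : nat} {m : 'I_N -> nat}
  (fbar : forall i : 'I_N, (LI r (m i) -> R) -> ('I_r * 'I_(m i))%type -> R)
  (Delta : (SI r m -> R) -> SI r m -> R)
  (x : SI r m -> R) (u : UI m -> R) : SI r m -> R :=
  fun s => match s with existT i jk => fbar i (@loc N r m x u i) jk end + Delta x s.

(* pure-feedback form: \bar f^i_{j} (0-based j with j+1 < r) depends only on
   the blocks x^i_1, ..., x^i_{j+2} (0-based blocks 0..j+1) and not on u^i;
   the last component (0-based r-1) depends on all of x^i and u^i. *)
Definition pure_feedback {N r : nat} {m : 'I_N -> nat}
  (fbar : forall i : 'I_N, (LI r (m i) -> R) -> ('I_r * 'I_(m i))%type -> R) : Prop :=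
  forall (i : 'I_N) (j : 'I_r) (k : 'I_(m i)) (p q : LI r (m i) -> R),
    (j.+1 < r)%N ->
    (forall (j' : 'I_r) (k' : 'I_(m i)), (j' <= j.+1)%N -> p (inl (j', k')) = q (inl (j', k'))) ->
    fbar i p (j, k) = fbar i q (j, k).

Definition regular_at {N r : nat} {m : 'I_N -> nat}
  (fbar : forall i : 'I_N, (LI r (m i) -> R) -> ('I_r * 'I_(m i))%type -> R)
  (xs : SI r m -> R) (us : UI m -> R) : Prop :=
  (forall (i : 'I_N) (jk : ('I_r * 'I_(m i))%type),
      exists U : (LI r (m i) -> R) -> Prop,
        is_open U /\ U (loc xs us i) /\ smooth_on U (fun p => fbar i p jk)) /\
  (forall (i : 'I_N) (j1 j2 : 'I_r), val j2 = (val j1).+1 ->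
      determinant (\matrix_(k < m i, l < m i)
              pd (fun p => fbar i p (j1, k)) (loc xs us i) (inl (j2, l))) <> 0) /\
  (forall (i : 'I_N) (j : 'I_r), (val j).+1 = r ->
      determinant (\matrix_(k < m i, l < m i)
              pd (fun p => fbar i p (j, k)) (loc xs us i) (inr l)) <> 0).

(* coordinates on which Delta^i_j may depend: substates of order <= j of all
   subsystems, and substates of order j+1 of subsystems with index < i
   (0-based orders). *)
Definition lt_coords {N r : nat} {m : 'I_N -> nat} (s : SI r m) : SI r m -> Prop :=
  fun s' => (val (projT2 s').1 <= val (projT2 s).1)%N \/
            (val (projT2 s').1 = (val (projT2 s).1).+1 /\ (val (projT1 s') < val (projT1 s))%N).

Definition lower_triangular_on {N r : nat} {m : 'I_N -> nat}
  (Delta : (SI r m -> R) -> SI r m -> R)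
  (X : ((SI r m + UI m)%type -> R) -> Prop) : Prop :=
  (forall s, smooth_on X (fun p => Delta (xpart p) s)) /\
  (forall s, exists Dbar : (SI r m -> R) -> R,
      forall p, X p -> Delta (xpart p) s = Dbar (mask (lt_coords s) (xpart p))).

Definition trajectory_in {SX UX : eqType} (F : (SX -> R) -> (UX -> R) -> SX -> R)
  (X : ((SX + UX)%type -> R) -> Prop) (a b : R)
  (x : R -> SX -> R) (u : R -> UX -> R) : Prop :=
  a < b /\
  (forall c n t, a < t < b -> ex_derive_n (fun s => x s c) n t) /\
  (forall c n t, a < t < b -> ex_derive_n (fun s => u s c) n t) /\
  (forall t, a < t < b ->
     X (join (x t) (u t)) /\
     forall c, is_derive (fun s => x s c) t (F (x t) (u t) c)).

Definition jet {C : eqType} (n : nat) (v : R -> C -> R) (t : R)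
  : (C * 'I_n.+1)%type -> R :=
  fun cn => Derive_n (fun s => v s cn.1) (val cn.2) t.

Definition diff_flat_on {SX UX YX : eqType}
  (F : (SX -> R) -> (UX -> R) -> SX -> R)
  (X : ((SX + UX)%type -> R) -> Prop)
  (alpha : nat) (h : ((SX + (UX * 'I_alpha.+1))%type -> R) -> YX -> R) : Prop :=
  (forall c : YX, smooth_on (fun _ => True) (fun p => h p c)) /\
  exists (beta : nat)
         (Phi : ((YX * 'I_beta.+1)%type -> R) -> SX -> R)
         (Psi : ((YX * 'I_beta.+1)%type -> R) -> UX -> R)
         (W : ((YX * 'I_beta.+1)%type -> R) -> Prop),
    is_open W /\
    (forall c, smooth_on W (fun q => Phi q c)) /\
    (forall c, smooth_on W (fun q => Psi q c)) /\
    forall a b x u, trajectory_in F X a b x u ->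
      forall t, a < t < b ->
        let y := fun s => h (join (x s) (jet alpha u s)) in
        W (jet beta y t) /\ x t = Phi (jet beta y t) /\ u t = Psi (jet beta y t).

Definition first_substates {N r : nat} {m : 'I_N -> nat} (hr : (0 < r)%N)
  (p : ((SI r m + (UI m * 'I_1))%type -> R)) : UI m -> R :=
  fun ik => p (inl (existT _ (projT1 ik) (Ordinal hr, projT2 ik))).

(* Main.v *)
(** The output [y = x_1] and its first [r] time derivatives are functions of [(x, u)] alone: they are
    the iterated Lie derivatives of the coordinates of [x_1] along the field.  Grade the coordinates
    by their order, the inputs having order [r].  The [n]-th Lie derivative depends only on coordinates
    of order at most [n], and its derivative with respect to the coordinates of order [n] is a product
    of the matrices [d F_j / d x_(j+1)], [j < n].  Each of these is block triangular over the
    subsystems, because the coupling reaches order [j + 1] only through smaller indices, and its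
    diagonal blocks are the invertible ones of the uncoupled dynamics.  Hence
    [(x, u) |-> (y, y', ..., y^(r))] is a map between spaces of equal dimension with invertible
    Jacobian at the operating point, and its smooth local inverse gives both flatness maps. *)
Require Import Defs.
From Stdlib Require Import Reals Lra ClassicalEpsilon FunctionalExtensionality.
From Coquelicot Require Import Coquelicot.
From mathcomp Require Import all_boot all_algebra.
From mathcomp Require Import perm Rstruct.

Set Implicit Arguments.
Unset Strict Implicit.

Local Open Scope R_scope.

(** Points are plain functions on an index type and smoothness is [Ck], iterated existence and
    continuity of coordinate partial derivatives; the mean value inequality, the chain rule and the
    inverse function theorem are derived from one-variable calculus for exactly this notion. The
    blocks have sizes [m i] that vary with the subsystem, so block matrices are never formed at the
    level of the joint Jacobian. Invertibility is handled through kernels instead: each factor of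
    the product and each triangular structure becomes an induction showing that a kernel vector
    vanishes order by order or subsystem by subsystem. The inputs act as one more substate without
    dynamics, which is why derivatives of [u] do not appear in the output derivatives up to order
    [r]. Triangularity holds only near the operating point, so dependence statements are relative to
    an open set. *)

Local Notation "\rsum_ i F" := (\big[Rplus/0]_i F)
  (at level 34, F at level 41, i at level 0).

(** * Finite sums and radii *)

Lemma rsum_le (I : finType) (F G : I -> R) :
  (forall c, F c <= G c) -> \rsum_c F c <= \rsum_c G c.
Proof.
move=> h; elim/big_ind2: _ => [|x1 x2 y1 y2 h1 h2|c _]; [lra | lra | exact: h].
Qed.

Lemma rsum_ge0 (I : finType) (F : I -> R) :
  (forall c, 0 <= F c) -> 0 <= \rsum_c F c.
Proof. by move=> h; elim/big_ind: _ => // *; lra. Qed.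

Lemma Rabs_rsum (I : finType) (F : I -> R) :
  Rabs (\rsum_c F c) <= \rsum_c Rabs (F c).
Proof.
elim/big_ind2: _ => [|x1 x2 y1 y2 h1 h2|c _]; last by lra.
  by rewrite Rabs_R0; lra.
by apply: Rle_trans (Rabs_triang _ _) _; lra.
Qed.

Lemma rsum_mulr (I : finType) (F : I -> R) (a : R) :
  (\rsum_c F c) * a = \rsum_c (F c * a).
Proof. by rewrite big_distrl. Qed.

Lemma rsum_mull (I : finType) (F : I -> R) (a : R) :
  a * (\rsum_c F c) = \rsum_c (a * F c).
Proof. by rewrite big_distrr. Qed.

Lemma rsum_add (I : finType) (F G : I -> R) :
  \rsum_c F c + \rsum_c G c = \rsum_c (F c + G c).
Proof. by rewrite big_split. Qed.

Lemma rsum_sub (I : finType) (F G : I -> R) :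
  \rsum_c F c - \rsum_c G c = \rsum_c (F c - G c).
Proof.
have -> : \rsum_c F c - \rsum_c G c = \rsum_c F c + (-1) * \rsum_c G c by ring.
by rewrite rsum_mull rsum_add; apply: eq_bigr => c _; ring.
Qed.

Lemma rsum_ge_term (I : finType) (F : I -> R) (c : I) :
  (forall c, 0 <= F c) -> F c <= \rsum_c F c.
Proof.
move=> h; rewrite (bigD1 c) //=.
suff : 0 <= \big[Rplus/0]_(i | i != c) F i by lra.
by elim/big_ind: _ => // *; lra.
Qed.

Lemma rsum_single (I : finType) (F : I -> R) (c : I) :
  (forall c', c' != c -> F c' = 0) -> \rsum_c F c = F c.
Proof.
move=> h; rewrite (bigD1 c) //= big1 ?Rplus_0_r // => c'; exact: h.
Qed.

(** Used to cut a full row of the Jacobian down to one diagonal block, whose columns [h]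
    enumerates. *)
Lemma rsum_image (I J : finType) (h : J -> I) (F : I -> R) :
  injective h -> (forall c, (forall l, c <> h l) -> F c = 0) ->
  \rsum_c F c = \rsum_l F (h l).
Proof.
move=> hinj h0.
rewrite (bigID (fun c => c \in codom h)) /= [X in _ + X]big1 ?Rplus_0_r; last first.
  move=> c hc; apply: h0 => l e; move: hc; rewrite e codom_f //.
rewrite (eq_bigl (fun c => c \in [set h l | l in [set: J]])); last first.
  move=> c; apply/codomP/imsetP => [[l ->]|[l _ ->]]; first by exists l.
  by exists l.
rewrite big_imset /=; last by move=> ? ? _ _; exact: hinj.
by apply: eq_bigl => l; rewrite inE.
Qed.

(** A minimum of finitely many radii. Finiteness of the set of coordinates enters the neighbourhood
    arguments here. *)
Lemma fin_radius (I : finType) (P : I -> R -> Prop) :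
  (forall c d d', P c d -> 0 < d' <= d -> P c d') ->
  (forall c, exists d, 0 < d /\ P c d) -> exists d, 0 < d /\ forall c, P c d.
Proof.
move=> mono h.
suff [d [d0 hd]] : exists d, 0 < d /\ forall c, c \in index_enum I -> P c d.
  by exists d; split=> // c; apply: hd; rewrite mem_index_enum.
elim: (index_enum I) => [|c s [d [d0 hd]]]; first by exists 1; split; [lra|].
have [e [e0 he]] := h c.
exists (Rmin d e); split; first exact: Rmin_pos.
move=> c'; rewrite inE => /orP[/eqP ->|/hd hc].
  by apply: mono he _; split; [exact: Rmin_pos | exact: Rmin_r].
by apply: mono hc _; split; [exact: Rmin_pos | exact: Rmin_l].
Qed.

(** * Coordinates, neighbourhoods and continuity *)

Lemma upd0 (I : eqType) (p : I -> R) c : upd p c 0 = p.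
Proof. by apply: functional_extensionality => d; rewrite /upd; case: eqP => // _; ring. Qed.

Lemma upd_upd (I : eqType) (p : I -> R) c s t : upd (upd p c s) c t = upd p c (s + t).
Proof. by apply: functional_extensionality => d; rewrite /upd; case: eqP => // _; ring. Qed.

Lemma upd_eq (I : eqType) (p : I -> R) c t : upd p c t c = p c + t.
Proof. by rewrite /upd eqxx. Qed.

Lemma upd_neq (I : eqType) (p : I -> R) c c' t : c' != c -> upd p c t c' = p c'.
Proof. by rewrite /upd => /negbTE ->. Qed.

Lemma near_refl (I : eqType) (p : I -> R) e : 0 < e -> near_pt p p e.
Proof. by move=> e0 c; rewrite Rminus_diag Rabs_R0. Qed.

Lemma near_le (I : eqType) (p q : I -> R) d e : near_pt p q d -> d <= e -> near_pt p q e.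
Proof. by move=> h de c; apply: Rlt_le_trans (h c) de. Qed.

Lemma near_upd (I : eqType) (p : I -> R) c t e : Rabs t < e -> near_pt p (upd p c t) e.
Proof.
move=> te c'; rewrite /upd; case: eqP => _.
  by have -> : p c' + t - p c' = t by ring.
by rewrite Rminus_diag Rabs_R0; apply: Rle_lt_trans te; exact: Rabs_pos.
Qed.

Lemma open_upd (I : eqType) (U : (I -> R) -> Prop) p c :
  is_open U -> U p -> locally 0 (fun t => U (upd p c t)).
Proof.
move=> oU /oU [e [e0 he]]; exists (mkposreal e e0) => t ht.
have {}ht : Rabs (t - 0) < e := ht.
by apply/he/near_upd; rewrite Rminus_0_r in ht.
Qed.

Lemma open_near (I : finType) (p : I -> R) e : is_open (fun q => near_pt p q e).
Proof.
move=> q hq.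
have [d [d0 hd]] : exists d, 0 < d /\ forall c, d <= e - Rabs (q c - p c).
  apply: (@fin_radius I (fun c d => d <= e - Rabs (q c - p c))); first by move=> *; lra.
  by move=> c; exists (e - Rabs (q c - p c)); split; [have := hq c; lra | lra].
exists d; split=> // x hx c.
have -> : x c - p c = (x c - q c) + (q c - p c) by ring.
by apply: Rle_lt_trans (Rabs_triang _ _) _; have := hx c; have := hd c; lra.
Qed.

Lemma is_open_and (I : eqType) (U V : (I -> R) -> Prop) :
  is_open U -> is_open V -> is_open (fun p => U p /\ V p).
Proof.
move=> oU oV p [/oU [d [d0 hd]] /oV [e [e0 he]]].
exists (Rmin d e); split; first exact: Rmin_pos.
by move=> q hq; split; [apply: hd|apply: he]; apply: near_le hq _; [exact: Rmin_l|exact: Rmin_r].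
Qed.

Lemma open_all (I : eqType) (J : finType) (U : J -> (I -> R) -> Prop) :
  (forall j, is_open (U j)) -> is_open (fun p => forall j, U j p).
Proof.
move=> oU p hp.
have [d [d0 hd]] : exists d, 0 < d /\ forall j q, near_pt p q d -> U j q.
  apply: (@fin_radius J (fun j d => forall q, near_pt p q d -> U j q)) => [|j]; last exact: oU.
  by move=> c d d' h [_ dd] q hq; apply: h; exact: near_le hq dd.
by exists d; split=> // q hq j; exact: hd.
Qed.

(** The trace on [U] of the neighbourhood filter of [p]. It turns [cont_on] into a [filterlim], to
    be composed with the limits of sums, products and inverses on the line. *)
Definition at_pt {I : eqType} (U : (I -> R) -> Prop) (p : I -> R) : ((I -> R) -> Prop) -> Prop :=
  fun P => exists d, 0 < d /\ forall q, U q -> near_pt p q d -> P q.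

#[local] Instance at_pt_filter (I : eqType) (U : (I -> R) -> Prop) p : Filter (at_pt U p).
Proof.
split.
- by exists 1; split; [lra|].
- move=> P Q [d [d0 hd]] [e [e0 he]].
  exists (Rmin d e); split; first exact: Rmin_pos.
  move=> q Uq hq; split; [apply: hd|apply: he] => //; apply: near_le hq _;
    [exact: Rmin_l|exact: Rmin_r].
- by move=> P Q PQ [d [d0 hd]]; exists d; split=> // q Uq hq; apply/PQ/hd.
Qed.

Lemma cont_onP (I : eqType) (U : (I -> R) -> Prop) F :
  cont_on U F <-> forall p, U p -> filterlim F (at_pt U p) (locally (F p)).
Proof.
split=> h p Up.
  move=> P [e he]; have [d [d0 hd]] := h p Up e (cond_pos e).
  by exists d; split=> // q Uq hq; apply: he; exact: hd.
move=> e e0; have [|d [d0 hd]] := h p Up (fun y => Rabs (y - F p) < e).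
  by exists (mkposreal e e0) => y.
by exists d.
Qed.

Lemma cont_on_comp2 (I : eqType) (U : (I -> R) -> Prop) (F G : (I -> R) -> R) (op : R -> R -> R) :
  (forall x y, filterlim (fun z => op z.1 z.2) (filter_prod (locally x) (locally y)) (locally (op x y))) ->
  cont_on U F -> cont_on U G -> cont_on U (fun p => op (F p) (G p)).
Proof.
move=> hop /cont_onP cF /cont_onP cG; apply/cont_onP => p Up.
exact: filterlim_comp_2 (cF p Up) (cG p Up) (hop _ _).
Qed.

Lemma cont_on_const (I : eqType) (U : (I -> R) -> Prop) a : cont_on U (fun=> a).
Proof. by apply/cont_onP => p _; exact: filterlim_const. Qed.

Lemma cont_on_proj (I : eqType) (U : (I -> R) -> Prop) c : cont_on U (fun p => p c).
Proof. by move=> p _ e e0; exists e; split=> // q _; apply. Qed.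

Lemma cont_on_plus (I : eqType) (U : (I -> R) -> Prop) F G :
  cont_on U F -> cont_on U G -> cont_on U (fun p => F p + G p).
Proof. apply: cont_on_comp2 => x y; exact: (filterlim_plus x y). Qed.

Lemma cont_on_mult (I : eqType) (U : (I -> R) -> Prop) F G :
  cont_on U F -> cont_on U G -> cont_on U (fun p => F p * G p).
Proof. apply: cont_on_comp2 => x y; exact: (filterlim_mult x y). Qed.

Lemma cont_on_inv (I : eqType) (U : (I -> R) -> Prop) F :
  (forall p, U p -> F p <> 0) -> cont_on U F -> cont_on U (fun p => / F p).
Proof.
move=> nz /cont_onP cF; apply/cont_onP => p Up.
apply: filterlim_comp (cF p Up) _.
by have := @continuous_Rinv (F p) (nz p Up).
Qed.

Lemma cont_on_ext (I : eqType) (U : (I -> R) -> Prop) F G :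
  (forall p, U p -> F p = G p) -> cont_on U F -> cont_on U G.
Proof.
move=> FG cF p Up e e0; have [d [d0 hd]] := cF p Up e e0.
by exists d; split=> // q Uq hq; rewrite -!FG //; exact: hd.
Qed.

Lemma cont_on_comp (I : eqType) (J : finType) (U : (I -> R) -> Prop) (V : (J -> R) -> Prop)
    (F : (J -> R) -> R) (g : (I -> R) -> J -> R) :
  (forall p, U p -> V (g p)) -> (forall j, cont_on U (fun p => g p j)) ->
  cont_on V F -> cont_on U (fun p => F (g p)).
Proof.
move=> UV cg cF p Up e e0; have [d [d0 hd]] := cF _ (UV p Up) e e0.
have [d' [d'0 hd']] : exists d', 0 < d' /\
    forall j q, U q -> near_pt p q d' -> Rabs (g q j - g p j) < d.
  apply: (@fin_radius J (fun j d' => forall q, U q -> near_pt p q d' -> Rabs (g q j - g p j) < d))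
    => [|j]; last exact: cg.
  by move=> c x x' h [_ xx] q Uq hq; apply: h => //; exact: near_le hq xx.
by exists d'; split=> // q Uq hq; apply: hd; [exact: UV|] => j; exact: hd'.
Qed.

Lemma open_preim (I : eqType) (U : (I -> R) -> Prop) (J : finType) (W : (J -> R) -> Prop)
    (g : (I -> R) -> J -> R) :
  is_open U -> is_open W -> (forall j, cont_on U (fun p => g p j)) ->
  is_open (fun p => U p /\ W (g p)).
Proof.
move=> oU oW cg p [Up /oW [e [e0 he]]]; have [d [d0 hd]] := oU p Up.
have [d' [d'0 hd']] : exists d', 0 < d' /\
    forall j q, U q -> near_pt p q d' -> Rabs (g q j - g p j) < e.
  apply: (@fin_radius J (fun j d' => forall q, U q -> near_pt p q d' -> Rabs (g q j - g p j) < e))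
    => [|j]; last exact: cg.
  by move=> c x x' h [_ xx] q Uq hq; apply: h => //; exact: near_le hq xx.
exists (Rmin d d'); split; first exact: Rmin_pos.
move=> q hq; have Uq : U q by apply: hd; apply: near_le hq _; exact: Rmin_l.
split=> //; apply: he => j; apply: hd' => //; apply: near_le hq _; exact: Rmin_r.
Qed.

(** * Calculus of [Ck] functions *)

Lemma pd_ext (I : eqType) (U : (I -> R) -> Prop) F G p c :
  is_open U -> (forall q, U q -> F q = G q) -> U p -> pd F p c = pd G p c.
Proof.
move=> oU FG Up; apply: Derive_ext_loc.
by apply: filter_imp (@open_upd _ _ _ c oU Up) => t /FG.
Qed.

Lemma Ck_cont (I : eqType) k (U : (I -> R) -> Prop) F : Ck k U F -> cont_on U F.
Proof. by case: k => [|k] //= []. Qed.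

Lemma Ck_ext (I : eqType) k (U : (I -> R) -> Prop) F G :
  is_open U -> (forall q, U q -> F q = G q) -> Ck k U F -> Ck k U G.
Proof.
move=> oU; elim: k F G => [|k IH] F G FG /=; first exact: cont_on_ext.
move=> [cF dF]; split; first exact: cont_on_ext cF.
move=> c; have [eF kF] := dF c; split.
  move=> p Up; apply: ex_derive_ext_loc (eF p Up).
  by apply: filter_imp (@open_upd _ _ _ c oU Up) => t /FG.
by apply: IH kF => q Uq; exact: pd_ext FG Uq.
Qed.

Lemma Ck_sub (I : eqType) k (U V : (I -> R) -> Prop) F :
  (forall p, V p -> U p) -> Ck k U F -> Ck k V F.
Proof.
move=> VU; have cont_sub G : cont_on U G -> cont_on V G.
  move=> cG p Vp e e0; have [d [d0 hd]] := cG p (VU _ Vp) e e0.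
  by exists d; split=> // q /VU; exact: hd.
elim: k F => [|k IH] F /=; first exact: cont_sub.
move=> [/cont_sub cF dF]; split=> // c; have [eF kF] := dF c.
by split; [move=> p /VU /eF | exact: IH].
Qed.

(** A formula [G], valid on [U], stands in for the total function [pd F]; openness of [U] transfers
    its regularity. *)
Lemma Ck_intro (I : eqType) k (U : (I -> R) -> Prop) F (G : I -> (I -> R) -> R) :
  is_open U -> cont_on U F ->
  (forall c p, U p -> is_derive (fun t => F (upd p c t)) 0 (G c p)) ->
  (forall c, Ck k U (G c)) -> Ck k.+1 U F.
Proof.
move=> oU cF dF kG; split=> // c; split; first by move=> p /(dF c) ?; exists (G c p).
by apply: Ck_ext (kG c) => // q /(dF c) h; symmetry; exact: is_derive_unique.
Qed.

Lemma Ck_derive (I : eqType) k (U : (I -> R) -> Prop) F p c :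
  Ck k.+1 U F -> U p -> is_derive (fun t => F (upd p c t)) 0 (pd F p c).
Proof. by move=> [_ /(_ c) [h _]] /h; exact: Derive_correct. Qed.

Lemma Ck_pd (I : eqType) k (U : (I -> R) -> Prop) F c :
  Ck k.+1 U F -> Ck k U (fun p => pd F p c).
Proof. by move=> [_ /(_ c) []]. Qed.

Lemma Ck_pred (I : eqType) k (U : (I -> R) -> Prop) F : Ck k.+1 U F -> Ck k U F.
Proof.
elim: k F => [|k IH] F; first by case.
move=> [cF dF]; split=> // c; have [eF kF] := dF c; split=> //; exact: IH.
Qed.

Lemma Ck_const (I : eqType) k (U : (I -> R) -> Prop) a : is_open U -> Ck k U (fun=> a).
Proof.
move=> oU; elim: k a => [|k IH] a; first exact: cont_on_const.
apply: (@Ck_intro _ _ _ _ (fun _ _ => 0)) => //; first exact: cont_on_const.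
by move=> c p _; exact: is_derive_const.
Qed.

Lemma derive_proj (I : eqType) (p : I -> R) (c a : I) :
  is_derive (fun t => upd p c t a) 0 (if a == c then 1 else 0).
Proof.
rewrite /upd; case: eqP => _; last exact: is_derive_const.
by auto_derive.
Qed.

Lemma pd_proj (I : eqType) (p : I -> R) (c a : I) :
  pd (fun q => q a) p c = if a == c then 1 else 0.
Proof. exact/is_derive_unique/derive_proj. Qed.

Lemma Ck_proj (I : eqType) k (U : (I -> R) -> Prop) a : is_open U -> Ck k U (fun p => p a).
Proof.
move=> oU; case: k => [|k]; first exact: cont_on_proj.
apply: (@Ck_intro _ _ _ _ (fun c _ => if a == c then 1 else 0)) => //.
- exact: cont_on_proj.
- by move=> c p _; exact: derive_proj.
- by move=> c; exact: Ck_const.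
Qed.

Lemma Ck_plus (I : eqType) k (U : (I -> R) -> Prop) F G : is_open U ->
  Ck k U F -> Ck k U G -> Ck k U (fun p => F p + G p).
Proof.
move=> oU; elim: k F G => [|k IH] F G kF kG; first exact: cont_on_plus.
apply: (@Ck_intro _ _ _ _ (fun c p => pd F p c + pd G p c)) => //.
- by apply: cont_on_plus; [exact: Ck_cont kF|exact: Ck_cont kG].
- by move=> c p Up; apply: is_derive_plus; [exact: Ck_derive kF Up|exact: Ck_derive kG Up].
- by move=> c; apply: IH; exact: Ck_pd.
Qed.

Lemma derive_mult (f g : R -> R) (x df dg : R) : is_derive f x df -> is_derive g x dg ->
  is_derive (fun t => f t * g t) x (df * g x + f x * dg).
Proof. by move=> hf hg; apply: is_derive_mult => //; exact: Rmult_comm. Qed.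

Lemma Ck_mult (I : eqType) k (U : (I -> R) -> Prop) F G : is_open U ->
  Ck k U F -> Ck k U G -> Ck k U (fun p => F p * G p).
Proof.
move=> oU; elim: k F G => [|k IH] F G kF kG; first exact: cont_on_mult.
apply: (@Ck_intro _ _ _ _ (fun c p => pd F p c * G p + F p * pd G p c)) => //.
- by apply: cont_on_mult; [exact: Ck_cont kF|exact: Ck_cont kG].
- move=> c p Up; have := derive_mult (Ck_derive c kF Up) (Ck_derive c kG Up).
  by rewrite upd0.
- move=> c; apply: Ck_plus => //; apply: IH;
    by [exact: Ck_pd | exact: Ck_pred].
Qed.

Lemma Ck_inv (I : eqType) k (U : (I -> R) -> Prop) F : is_open U ->
  (forall p, U p -> F p <> 0) -> Ck k U F -> Ck k U (fun p => / F p).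
Proof.
move=> oU nz; elim: k => [|k IH] kF; first exact: cont_on_inv.
(* The derivative is written as a product in which [/ F] itself occurs, needed only at the lower
   degree [k], so the induction closes. *)
apply: (@Ck_intro _ _ _ _ (fun c p => (-1 * pd F p c) * (/ F p * / F p))) => //.
- by apply: cont_on_inv => //; exact: Ck_cont kF.
- move=> c p Up.
  have nz' : F (upd p c 0) <> 0 by rewrite upd0; exact: nz.
  have := is_derive_inv _ _ _ (Ck_derive c kF Up) nz'.
  rewrite upd0 => h; apply: is_derive_ext_loc; last first.
    have -> : (-1 * pd F p c) * (/ F p * / F p) = - pd F p c / F p ^ 2.
      by field; exact: nz.
    exact: h.
  exact: filter_forall.
- move=> c; apply: Ck_mult => //; last by apply: Ck_mult => //; apply: IH; exact: Ck_pred.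
  by apply: Ck_mult => //; [exact: Ck_const|exact: Ck_pd].
Qed.

Lemma Ck_big (I : eqType) (J : Type) k (U : (I -> R) -> Prop) (op : R -> R -> R) (x : R)
    (s : seq J) (P : pred J) (F : J -> (I -> R) -> R) : is_open U ->
  (forall f g, Ck k U f -> Ck k U g -> Ck k U (fun p => op (f p) (g p))) ->
  (forall j, Ck k U (F j)) -> Ck k U (fun p => \big[op/x]_(j <- s | P j) F j p).
Proof.
move=> oU hop kF; elim: s => [|j s IH].
  by apply: Ck_ext (Ck_const k x oU) => // q _; rewrite big_nil.
case Pj: (P j); last by apply: Ck_ext IH => // q _; rewrite big_cons Pj.
by apply: Ck_ext (hop _ _ (kF j) IH) => // q _; rewrite big_cons Pj.
Qed.

Lemma Ck_rsum (I : eqType) (J : finType) k (U : (I -> R) -> Prop) (F : J -> (I -> R) -> R) :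
  is_open U -> (forall j, Ck k U (F j)) -> Ck k U (fun p => \rsum_j F j p).
Proof. by move=> oU kF; apply: Ck_big => // f g; exact: Ck_plus. Qed.

Lemma Ck_det (I : eqType) k (U : (I -> R) -> Prop) n (M : (I -> R) -> 'M[R]_n) :
  is_open U -> (forall i j, Ck k U (fun p => M p i j)) -> Ck k U (fun p => determinant (M p)).
Proof.
move=> oU kM; apply: (@Ck_big I _ k U Rplus 0) => // [f g|s]; first exact: Ck_plus.
have kP : Ck k U (fun p => \big[Rmult/1]_i M p i (s i)).
  by apply: Ck_big => // f g; exact: Ck_mult.
exact: (Ck_mult oU (Ck_const k ((-1) ^+ s)%R oU) kP).
Qed.

(** Cramer's rule: where the determinant is nonzero, [invmx] consists of cofactors divided by it. *)
Lemma Ck_invmx (I : eqType) k (U : (I -> R) -> Prop) n (M : (I -> R) -> 'M[R]_n) :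
  is_open U -> (forall p, U p -> determinant (M p) <> 0) ->
  (forall i j, Ck k U (fun p => M p i j)) ->
  forall i j, Ck k U (fun p => invmx (M p) i j).
Proof.
move=> oU nz kM i j.
have kd : Ck k U (fun p => / determinant (M p)) by apply: Ck_inv => //; exact: Ck_det.
have kc : Ck k U (fun p => cofactor (M p) j i).
  have kP : Ck k U (fun p => determinant (row' j (col' i (M p)))).
    apply: Ck_det => // a b; apply: Ck_ext (kM (lift j a) (lift i b)) => // q _.
    by rewrite !mxE.
  exact: (Ck_mult oU (Ck_const k ((-1) ^+ (j + i))%R oU) kP).
apply: Ck_ext (Ck_mult oU kd kc) => // q /nz /eqP hq.
by rewrite /invmx unitmxE GRing.unitfE hq !mxE RinvE.
Qed.

(** * Mean value estimates and the chain rule *)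

(** [Ck] speaks of derivatives at time 0 from each base point; shifting the base point gives them at
    every [t] of a coordinate line, as the mean value theorem requires. *)
Lemma derive_upd (I : eqType) (F : (I -> R) -> R) p c t l :
  is_derive (fun s => F (upd (upd p c t) c s)) 0 l ->
  is_derive (fun s => F (upd p c s)) t l.
Proof.
move=> h.
apply: (is_derive_ext (fun s => (fun s => F (upd (upd p c t) c s)) (s - t))).
  by move=> s; rewrite upd_upd; congr (F (upd p c _)); ring.
have -> : l = scal 1 l by rewrite /scal /= /mult /= Rmult_1_l.
apply: (is_derive_comp (fun s => F (upd (upd p c t) c s)) (fun s => s - t)).
  by rewrite Rminus_diag.
by auto_derive; rewrite ?Rmult_1_r //; ring.
Qed.

(** Travel from [p] to [q] one coordinate at a time and apply the one-variable mean value theorem to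
    each leg. [L] is any fixed linear form within [eps] of all gradients in the box. *)
Lemma mean_value_box (I : finType) (F : (I -> R) -> R) (D : (I -> R) -> I -> R) (L : I -> R) p0 rho eps :
  (forall x c, near_pt p0 x rho ->
     is_derive (fun t => F (upd x c t)) 0 (D x c) /\ Rabs (D x c - L c) <= eps) ->
  forall p q, near_pt p0 p rho -> near_pt p0 q rho ->
  Rabs (F q - F p - \rsum_c (L c * (q c - p c))) <= eps * \rsum_c Rabs (q c - p c).
Proof.
move=> hD p q hp hq.
(* The induction runs over the coordinates still to be moved; outside that list the two points
   agree. *)
have : forall c, c \notin index_enum I -> p c = q c by move=> c; rewrite mem_index_enum.
have : uniq (index_enum I) by exact: index_enum_uniq.
elim: (index_enum I) p hp => [|c s IH] p hp.
  move=> _ h; have -> : p = q by apply: functional_extensionality => c; exact: h.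
  by rewrite !big_nil !Rminus_diag Rabs_R0; lra.
rewrite cons_uniq => /andP[cs us] h; rewrite !big_cons.
set p' := upd p c (q c - p c).
have p'c : p' c = q c by rewrite /p' upd_eq; ring.
have p'N d : d != c -> p' d = p d by exact: upd_neq.
have hp' : near_pt p0 p' rho.
  by move=> d; case: (eqVneq d c) => [->|/p'N ->]; [rewrite p'c; exact: hq|exact: hp].
have {IH} := IH p' hp' us.
have -> : \big[Rplus/0]_(j <- s) Rabs (q j - p' j) = \big[Rplus/0]_(j <- s) Rabs (q j - p j).
  by apply: eq_big_seq => j js; rewrite p'N //; apply: contraNneq cs => <-.
have -> : \big[Rplus/0]_(j <- s) (L j * (q j - p' j)) = \big[Rplus/0]_(j <- s) (L j * (q j - p j)).
  by apply: eq_big_seq => j js; rewrite p'N //; apply: contraNneq cs => <-.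
move=> IH.
have box t : Rmin 0 (q c - p c) <= t <= Rmax 0 (q c - p c) -> near_pt p0 (upd p c t) rho.
  move=> ht d; case: (eqVneq d c) => [->|dc]; last by rewrite upd_neq //; exact: hp.
  rewrite upd_eq; have := hp c; have := hq c; move: ht.
  rewrite /Rmin /Rmax; case: Rle_dec => _ ? /Rabs_def2 ? /Rabs_def2 ?; apply: Rabs_def1; lra.
have der t : Rmin 0 (q c - p c) <= t <= Rmax 0 (q c - p c) ->
    is_derive (fun s => F (upd p c s)) t (D (upd p c t) c).
  by move=> /box /(hD _ c) [/derive_upd].
have [xi [hxi]] := MVT_gen (fun t => F (upd p c t)) 0 (q c - p c) (fun t => D (upd p c t) c)
   (fun t ht => der t (conj (Rlt_le _ _ (proj1 ht)) (Rlt_le _ _ (proj2 ht))))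
   (fun t ht => proj2 (continuity_pt_filterlim _ _) (ex_derive_continuous _ _ (ex_intro _ _ (der t ht)))).
rewrite upd0 -/p' => mv.
have [_ bnd] := hD _ c (box _ hxi).
set A := \big[Rplus/0]_(j <- s) _; set B := \big[Rplus/0]_(j <- s) _.
have -> : F q - F p - (L c * (q c - p c) + A) =
    (F q - F p' - A) + (D (upd p c xi) c - L c) * (q c - p c) by lra.
apply: Rle_trans (Rabs_triang _ _) _; rewrite Rabs_mult.
have IH' : Rabs (F q - F p' - A) <= eps * B.
  apply: IH => d ds; case: (eqVneq d c) => [->|dc] //; rewrite p'N //.
  by apply: h; rewrite inE negb_or dc.
have := Rmult_le_compat_r _ _ _ (Rabs_pos (q c - p c)) bnd.
lra.
Qed.

Lemma derive_eps (f : R -> R) (x l : R) :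
  is_derive f x l <->
  forall eps, 0 < eps -> exists d, 0 < d /\
    forall h, Rabs h < d -> Rabs (f (x + h) - f x - l * h) <= eps * Rabs h.
Proof.
have conv h : h <> 0 -> f (x + h) - f x - l * h = ((f (x + h) - f x) / h - l) * h.
  by move=> h0; field.
split.
  move=> /is_derive_Reals D eps e0; have [d hd] := D eps e0.
  exists d; split=> [|h hh]; first exact: cond_pos.
  case: (Req_dec h 0) => [->|h0].
    by rewrite Rplus_0_r Rmult_0_r !Rminus_diag Rabs_R0; lra.
  rewrite (conv h h0) Rabs_mult; apply: Rmult_le_compat_r; first exact: Rabs_pos.
  exact/Rlt_le/hd.
move=> H; apply/is_derive_Reals => eps e0.
have [|d [d0 hd]] := H (eps / 2); first by lra.
exists (mkposreal d d0) => h h0 /= /hd; rewrite (conv h h0) Rabs_mult => hh.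
by have := Rmult_le_reg_r _ _ _ (Rabs_pos_lt h h0) hh; lra.
Qed.

(** Strict differentiability: both endpoints vary while the gradient stays frozen at [p]. This is
    what yields a contraction estimate on a whole ball. *)
Lemma C1_differentiable (I : finType) (U : (I -> R) -> Prop) F p eps :
  is_open U -> Ck 1 U F -> U p -> 0 < eps ->
  exists d, 0 < d /\ forall q q', near_pt p q d -> near_pt p q' d ->
    U q /\ Rabs (F q' - F q - \rsum_c (pd F p c * (q' c - q c))) <= eps * \rsum_c Rabs (q' c - q c).
Proof.
move=> oU kF Up e0; have [d [d0 hd]] := oU p Up.
have [d' [d'0 hd']] : exists d', 0 < d' /\
    forall c q, U q -> near_pt p q d' -> Rabs (pd F q c - pd F p c) < eps.
  apply: (@fin_radius I (fun c d' => forall q, U q -> near_pt p q d' -> Rabs (pd F q c - pd F p c) < eps)).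
    by move=> c x x' h [_ xx] q Uq hq; apply: h => //; exact: near_le hq xx.
  by move=> c; exact: (Ck_cont (Ck_pd c kF) Up e0).
exists (Rmin d d'); split; first exact: Rmin_pos.
have inU x : near_pt p x (Rmin d d') -> U x.
  by move=> hx; apply: hd; apply: near_le hx _; exact: Rmin_l.
move=> q q' hq hq'; split; first exact: inU.
apply: (@mean_value_box I F (pd F) (pd F p) p (Rmin d d') eps _ q q' hq hq') => x c hx; split.
  by apply: Ck_derive kF _; exact: inU.
by apply/Rlt_le/hd'; [exact: inU|apply: near_le hx _; exact: Rmin_r].
Qed.

Lemma near_rsum (I : finType) (p q : I -> R) e : \rsum_c Rabs (q c - p c) < e -> near_pt p q e.
Proof.
move=> h c; apply: Rle_lt_trans h.
by apply: (@rsum_ge_term I (fun c => Rabs (q c - p c))) => ?; exact: Rabs_pos.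
Qed.

Lemma chain_curve (I : finType) (U : (I -> R) -> Prop) F (g : R -> I -> R) (t0 : R) (dg : I -> R) :
  is_open U -> Ck 1 U F -> U (g t0) -> (forall c, is_derive (fun t => g t c) t0 (dg c)) ->
  is_derive (fun t => F (g t)) t0 (\rsum_c (pd F (g t0) c * dg c)).
Proof.
move=> oU kF Ug Dg; apply/derive_eps => eps e0.
set A := \rsum_c Rabs (pd F (g t0) c); set B := \rsum_c (Rabs (dg c) + 1).
have A0 : 0 <= A by apply: rsum_ge0 => c; exact: Rabs_pos.
have B0 : 0 <= B by apply: rsum_ge0 => c; have := Rabs_pos (dg c); lra.
(* Half of [eps] pays for the nonlinearity of [F], an error of at most [e1 * B * |h|]. *)
set e1 := eps / (2 * (B + 1)).
have e10 : 0 < e1 by apply: Rdiv_lt_0_compat; lra.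
have [d1 [d10 hd1]] := C1_differentiable oU kF Ug e10.
(* The other half pays for the nonlinearity of the curve, weighted by [A]. The cap at 1 bounds the
   increments by [(|dg c| + 1) * |h|], whence the 1 in [B]. *)
set e2 := Rmin 1 (eps / (2 * (A + 1))).
have e20 : 0 < e2 by apply: Rmin_pos; [lra|apply: Rdiv_lt_0_compat; lra].
have [d2 [d20 hd2]] : exists d2, 0 < d2 /\ forall c h, Rabs h < d2 ->
    Rabs (g (t0 + h) c - g t0 c - dg c * h) <= e2 * Rabs h.
  apply: (@fin_radius I (fun c d2 => forall h, Rabs h < d2 ->
    Rabs (g (t0 + h) c - g t0 c - dg c * h) <= e2 * Rabs h)).
    by move=> c x x' h [_ xx] y hy; apply: h; lra.
  by move=> c; move/derive_eps: (Dg c); exact.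
exists (Rmin d2 (d1 / (B + 1))); split.
  by apply: Rmin_pos => //; apply: Rdiv_lt_0_compat; lra.
move=> h hh.
have hh2 : Rabs h < d2 by apply: Rlt_le_trans hh (Rmin_l _ _).
have hh1 : Rabs h * (B + 1) < d1.
  apply/(Rlt_div_r (Rabs h) d1 (B + 1)); first lra.
  by apply: Rlt_le_trans hh (Rmin_r _ _).
have inc c : Rabs (g (t0 + h) c - g t0 c) <= (Rabs (dg c) + 1) * Rabs h.
  have -> : g (t0 + h) c - g t0 c = (g (t0 + h) c - g t0 c - dg c * h) + dg c * h by ring.
  apply: Rle_trans (Rabs_triang _ _) _; rewrite (Rabs_mult (dg c)).
  have := hd2 c h hh2; have := Rmin_l 1 (eps / (2 * (A + 1))); rewrite -/e2.
  move=> /(Rmult_le_compat_r _ _ _ (Rabs_pos h)); lra.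
have incs : \rsum_c Rabs (g (t0 + h) c - g t0 c) <= B * Rabs h.
  by rewrite /B rsum_mulr; apply: rsum_le => c; exact: inc.
have [_ H1] := hd1 (g t0) (g (t0 + h)) (near_refl (g t0) d10) ltac:(apply: near_rsum; have := Rabs_pos h; lra).
have H2 : Rabs (\rsum_c (pd F (g t0) c * (g (t0 + h) c - g t0 c)) - (\rsum_c (pd F (g t0) c * dg c)) * h)
   <= A * (e2 * Rabs h).
  rewrite rsum_mulr rsum_sub; apply: Rle_trans (Rabs_rsum _) _; rewrite /A rsum_mulr.
  apply: rsum_le => c.
  have -> : pd F (g t0) c * (g (t0 + h) c - g t0 c) - pd F (g t0) c * dg c * h =
    pd F (g t0) c * (g (t0 + h) c - g t0 c - dg c * h) by ring.
  rewrite Rabs_mult; apply: Rmult_le_compat_l; [exact: Rabs_pos|exact: hd2].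
set S := \rsum_c (pd F (g t0) c * (g (t0 + h) c - g t0 c)) in H1 H2.
set S' := \rsum_c (pd F (g t0) c * dg c) in H2 *.
have -> : F (g (t0 + h)) - F (g t0) - S' * h = (F (g (t0 + h)) - F (g t0) - S) + (S - S' * h) by ring.
apply: Rle_trans (Rabs_triang _ _) _.
have H3 : e1 * (B * Rabs h) <= eps / 2 * Rabs h.
  rewrite -Rmult_assoc; apply: Rmult_le_compat_r; first exact: Rabs_pos.
  have -> : eps / 2 = e1 * (B + 1) by rewrite /e1; field; lra.
  by apply: Rmult_le_compat_l; lra.
have H4 : A * (e2 * Rabs h) <= eps / 2 * Rabs h.
  rewrite -Rmult_assoc; apply: Rmult_le_compat_r; first exact: Rabs_pos.
  have -> : eps / 2 = (A + 1) * (eps / (2 * (A + 1))) by field; lra.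
  by apply: Rmult_le_compat; [lra|lra|lra|exact: Rmin_r].
have := Rmult_le_compat_l _ _ _ (Rlt_le _ _ e10) incs; lra.
Qed.

Lemma Ck_comp (I : eqType) (J : finType) k (U : (I -> R) -> Prop) (V : (J -> R) -> Prop)
    (F : (J -> R) -> R) (g : (I -> R) -> J -> R) :
  is_open U -> is_open V -> (forall p, U p -> V (g p)) ->
  (forall j, Ck k U (fun p => g p j)) -> Ck k V F -> Ck k U (fun p => F (g p)).
Proof.
move=> oU oV UV; elim: k F => [|k IH] F kg kF.
  by apply: cont_on_comp kF => //.
apply: (@Ck_intro _ _ _ _ (fun c p => \rsum_j (pd F (g p) j * pd (fun q => g q j) p c))) => //.
- by apply: cont_on_comp (Ck_cont kF) => // j; exact: Ck_cont (kg j).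
- move=> c p Up.
  have Ck1 : Ck 1 V F by elim: k {IH kg} kF => // k IH /Ck_pred; exact: IH.
  have := @chain_curve J V F (fun t => g (upd p c t)) 0 (fun j => pd (fun q => g q j) p c) oV Ck1.
  rewrite upd0; apply; first exact: UV.
  by move=> j; exact: Ck_derive (kg j) Up.
- move=> c; apply: Ck_rsum => // j; apply: Ck_mult => //; last exact: Ck_pd (kg j).
  apply: (IH (fun q => pd F q j)); last exact: Ck_pd kF.
  by move=> i; exact: Ck_pred (kg i).
Qed.

(** * The inverse function theorem *)

Definition delta {I : eqType} (a c : I) : R := if a == c then 1 else 0.

Lemma rsum_delta (I : finType) (F : I -> R) a : \rsum_c (delta a c * F c) = F a.
Proof.
rewrite (@rsum_single I _ a) /delta ?eqxx; first ring.
by move=> c ca; rewrite eq_sym (negbTE ca); ring.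
Qed.

(** Coordinates are numbered by [enum_val] to have determinants and [invmx] at hand; [inv_jacobian]
    returns to indices in [I]. *)
Definition jacobian {I : finType} (T : (I -> R) -> I -> R) (p : I -> R) : 'M[R]_#|I| :=
  \matrix_(i, j) pd (fun q => T q (enum_val i)) p (enum_val j).

Definition inv_jacobian {I : finType} (T : (I -> R) -> I -> R) (p : I -> R) (a b : I) : R :=
  invmx (jacobian T p) (enum_rank a) (enum_rank b).

Lemma rsum_enum (I : finType) (F : I -> R) : \big[Rplus/0]_(i < #|I|) F (enum_val i) = \rsum_c F c.
Proof.
rewrite [RHS](reindex (@enum_val I I)) /=; first exact: eq_bigl.
exact: onW_bij (enum_val_bij I).
Qed.

Lemma inv_jacobianP (I : finType) (T : (I -> R) -> I -> R) p :
  determinant (jacobian T p) <> 0 ->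
  forall a b, \rsum_c (inv_jacobian T p a c * pd (fun q => T q c) p b) = delta a b.
Proof.
move=> /eqP nz a b.
have : (invmx (jacobian T p) *m jacobian T p)%R = (1%:M)%R.
  by apply: mulVmx; rewrite unitmxE GRing.unitfE.
move=> /matrixP /(_ (enum_rank a) (enum_rank b)); rewrite [LHS]mxE [RHS]mxE (inj_eq enum_rank_inj) => H.
transitivity ((a == b)%:R : R)%R; last by rewrite /delta; case: eqP.
rewrite -H -rsum_enum; apply: eq_bigr => i _.
by rewrite /inv_jacobian enum_valK [jacobian T p i _]mxE enum_rankK.
Qed.

(** A zero determinant, passed to the transpose, yields a nonzero kernel vector. Invertibility at a
    base point is obtained below from this criterion. *)
Lemma jacobian_kernel (I : finType) (T : (I -> R) -> I -> R) p :
  (forall v : I -> R, (forall a, \rsum_c (pd (fun q => T q a) p c * v c) = 0) -> forall c, v c = 0) ->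
  determinant (jacobian T p) <> 0.
Proof.
move=> ker /eqP; rewrite -det_tr => /det0P [v v0 vM].
suff : v = 0%R by apply/eqP.
have h : forall c : I, v ord0 (enum_rank c) = 0.
  apply: (ker (fun c : I => v ord0 (enum_rank c))) => a.
  move/matrixP: vM => /(_ ord0 (enum_rank a)); rewrite [LHS]mxE [RHS]mxE => H.
  transitivity (0%R : R) => //; rewrite -H -rsum_enum; apply: eq_bigr => i _.
  by rewrite enum_valK [(jacobian T p)^T%R _ _]mxE [jacobian T p _ i]mxE enum_rankK; exact: Rmult_comm.
apply/matrixP => i j; rewrite !mxE (ord1 i) -(enum_valK j); exact: h.
Qed.

(** [T] minus the identity contracts by 1/2 in the l1 norm; this gives injectivity directly and
    local surjectivity by iteration. *)
Definition near_identity {I : finType} (B : (I -> R) -> Prop) (T : (I -> R) -> I -> R) : Prop :=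
  forall q q', B q -> B q' ->
  \rsum_a Rabs (T q' a - T q a - (q' a - q a)) <= / 2 * \rsum_a Rabs (q' a - q a).

Lemma near_identity_expand (I : finType) (B : (I -> R) -> Prop) (T : (I -> R) -> I -> R) q q' :
  near_identity B T -> B q -> B q' ->
  \rsum_a Rabs (q' a - q a) <= 2 * \rsum_a Rabs (T q' a - T q a).
Proof.
move=> nT Bq Bq'.
suff : \rsum_a Rabs (q' a - q a) <=
    \rsum_a Rabs (T q' a - T q a) + \rsum_a Rabs (T q' a - T q a - (q' a - q a)).
  by have := nT q q' Bq Bq'; lra.
rewrite rsum_add; apply: rsum_le => a; set x := T _ _ - _.
set y := q' a - q a; have := Rabs_triang x (- (x - y)); rewrite Rabs_Ropp.
by have -> : x + - (x - y) = y by ring.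
Qed.

Lemma rsum_Rabs_triang (I : finType) (p q x : I -> R) :
  \rsum_a Rabs (x a - p a) <= \rsum_a Rabs (q a - p a) + \rsum_a Rabs (x a - q a).
Proof.
rewrite rsum_add; apply: rsum_le => a.
have -> : x a - p a = (q a - p a) + (x a - q a) by ring.
exact: Rabs_triang.
Qed.

Lemma rsum_near (I : finType) (p q : I -> R) e :
  near_pt p q e -> \rsum_a Rabs (q a - p a) <= (\big[Rplus/0]_(a : I) 1) * e.
Proof. by move=> h; rewrite rsum_mulr; apply: rsum_le => a; have := h a; lra. Qed.

Lemma eventually_all (I : finType) (P : I -> nat -> Prop) :
  (forall c, eventually (P c)) -> eventually (fun n => forall c, P c n).
Proof.
move=> h.
have : eventually (fun n => forall c, c \in index_enum I -> P c n).
  elim: (index_enum I) => [|c s IH]; first by exists 0%N.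
  apply: filter_imp (filter_and _ _ (h c) IH) => n [h1 h2] c'.
  by rewrite inE => /orP[/eqP ->|/h2].
by apply: filter_imp => n hn c; apply: hn; rewrite mem_index_enum.
Qed.

(* Banach iteration [p |-> p - T p + z]. *)
Lemma near_identity_onto (I : finType) (T : (I -> R) -> I -> R) (p1 z : I -> R) (rho : R) :
  near_identity (fun p => near_pt p1 p rho) T ->
  (forall a, cont_on (fun p => near_pt p1 p rho) (fun p => T p a)) ->
  2 * \rsum_a Rabs (z a - T p1 a) < rho ->
  exists p, near_pt p1 p rho /\ T p = z.
Proof.
move=> nT cT; set s := \rsum_a Rabs (z a - T p1 a) => hs.
pose P := fix P n := if n is n'.+1 then fun a => P n' a - T (P n') a + z a else p1.
have s0 : 0 <= s by apply: rsum_ge0 => a; exact: Rabs_pos.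
have half n : 0 < (/ 2) ^ n by apply: pow_lt; lra.
(* The two bounds need each other: the steps halve only inside the ball, and the iterates stay
   within [2 * s < rho] of [p1] only because the steps halve. *)
have inv n : \rsum_a Rabs (P n a - p1 a) <= 2 * s * (1 - (/ 2) ^ n) /\
             \rsum_a Rabs (P n.+1 a - P n a) <= s * (/ 2) ^ n.
  have step k : \rsum_a Rabs (P k a - p1 a) <= 2 * s * (1 - (/ 2) ^ k) -> near_pt p1 (P k) rho.
    by move=> h; apply: near_rsum; have := half k; nra.
  elim: n => [|n [h1 h2]].
    split; first by rewrite big1 /= => [|a _]; rewrite ?Rminus_diag ?Rabs_R0; lra.
    rewrite /= Rmult_1_r; apply: rsum_le => a; apply: Req_le; congr Rabs; ring.
  have h3 : \rsum_a Rabs (P n.+1 a - p1 a) <= 2 * s * (1 - (/ 2) ^ n.+1).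
    by apply: Rle_trans (rsum_Rabs_triang _ (P n) _) _; move: h1 h2 => /=; lra.
  split=> //.
  have := nT _ _ (step _ h1) (step _ h3).
  have -> : \rsum_a Rabs (T (P n.+1) a - T (P n) a - (P n.+1 a - P n a)) =
            \rsum_a Rabs (P n.+2 a - P n.+1 a).
    by apply: eq_bigr => a _; rewrite Rabs_minus_sym; congr Rabs; rewrite /=; ring.
  by move: h2; rewrite [(/ 2) ^ n.+1]/=; lra.
have coord (x y : I -> R) a : Rabs (y a - x a) <= \rsum_a Rabs (y a - x a).
  by apply: (@rsum_ge_term I (fun a => Rabs (y a - x a))) => ?; exact: Rabs_pos.
(* Telescoping series dominated by a geometric one. *)
have cvg a : exists l : R, is_lim_seq (fun n => P n a) l.
  have [l hl] : ex_series (fun n => P n.+1 a - P n a).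
    apply: (ex_series_le _ (fun n => s * (/ 2) ^ n)).
      by move=> n; apply: Rle_trans (coord _ _ a) _; have [] := inv n.
    apply: (ex_series_scal_l s (fun n => (/ 2) ^ n)); apply: ex_series_geom.
    by rewrite Rabs_pos_eq; lra.
  exists (l + p1 a); apply/is_lim_seq_incr_1.
  apply: (is_lim_seq_ext (fun n => sum_n (fun n => P n.+1 a - P n a) n + p1 a)).
    elim=> [|n IH]; first by rewrite sum_O /=; ring.
    rewrite sum_Sn; set x := sum_n _ n in IH *.
    by have -> : plus x (P n.+2 a - P n.+1 a) = x + (P n.+2 a - P n.+1 a) by []; lra.
  by apply: is_lim_seq_plus'; [exact: hl|exact: is_lim_seq_const].
pose l a := proj1_sig (constructive_indefinite_description _ (cvg a)).
have hl a : is_lim_seq (fun n => P n a) (l a).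
  exact: (proj2_sig (constructive_indefinite_description _ (cvg a))).
have bnd n a : Rabs (P n a - p1 a) <= 2 * s.
  by apply: Rle_trans (coord _ _ a) _; have [h _] := inv n; have := half n; nra.
have inB n : near_pt p1 (P n) rho by move=> a; have := bnd n a; lra.
have lB : near_pt p1 l rho.
  move=> a; apply: Rle_lt_trans hs.
  have h : is_lim_seq (fun n => Rabs (P n a - p1 a)) (Rabs (l a - p1 a)).
    apply: (is_lim_seq_abs _ (l a - p1 a)).
    by apply: is_lim_seq_minus'; [exact: hl|exact: is_lim_seq_const].
  exact: (is_lim_seq_le _ _ (Rabs (l a - p1 a)) (2 * s) (fun n => bnd n a) h (is_lim_seq_const _)).
have evl d : 0 < d -> eventually (fun n => near_pt l (P n) d).
  move=> d0; apply: eventually_all => a.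
  have [n hn] := proj2 (is_lim_seq_spec _ _) (hl a) (mkposreal d d0).
  by exists n.
exists l; split=> //; apply: functional_extensionality => a.
apply: cond_eq => eps e0.
(* Since [T (P n) - z] equals [P n - P n.+1], the budget is [eps / 2] for the continuity of [T] and
   [eps / 4] for each of two consecutive iterates. *)
have [|d [d0 hd]] := cT a l lB (eps / 2); first lra.
have [n [hn1 hn2]] : exists n, near_pt l (P n) d /\ forall m, (n <= m)%coq_nat -> near_pt l (P m) (eps / 4).
  have [n1 h1] := evl d d0; have [|n2 h2] := evl (eps / 4); first lra.
  exists (Nat.max n1 n2); split; first by apply: h1; exact: Nat.le_max_l.
  by move=> m hm; apply: h2; apply: Nat.le_trans hm; exact: Nat.le_max_r.
have h1 := hd (P n) (inB n) hn1.
have h2 := hn2 n (le_n _) a; have h3 := hn2 n.+1 (le_S _ _ (le_n _)) a.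
have eqn : P n.+1 a = P n a - T (P n) a + z a by [].
move: h1 h2 h3 => /Rabs_def2 ? /Rabs_def2 ? /Rabs_def2 ?; apply: Rabs_def1; lra.
Qed.

Lemma derive_rsum (J : finType) (f : J -> R -> R) (x : R) (df : J -> R) :
  (forall j, is_derive (f j) x (df j)) ->
  is_derive (fun t => \rsum_j f j t) x (\rsum_j df j).
Proof.
move=> h; elim: (index_enum J) => [|j s IH].
  rewrite big_nil; apply: (is_derive_ext (fun=> 0)); last exact: is_derive_const.
  by move=> t; rewrite big_nil.
rewrite big_cons; apply: is_derive_ext; last exact: is_derive_plus (h j) IH.
by move=> t; rewrite big_cons.
Qed.

Lemma smooth_pd (I : eqType) (U : (I -> R) -> Prop) F c :
  smooth_on U F -> smooth_on U (fun p => pd F p c).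
Proof. by move=> sF k; exact: Ck_pd (sF k.+1). Qed.

Lemma smooth_jacobian (I : finType) (U : (I -> R) -> Prop) (T : (I -> R) -> I -> R) i j :
  is_open U -> (forall a, smooth_on U (fun p => T p a)) -> smooth_on U (fun p => jacobian T p i j).
Proof.
move=> oU sT k; apply: Ck_ext (smooth_pd (enum_val j) (sT (enum_val i)) k) => // q _.
by rewrite mxE.
Qed.

Lemma smooth_inv_jacobian (I : finType) (U : (I -> R) -> Prop) (T : (I -> R) -> I -> R) a b :
  is_open U -> (forall a, smooth_on U (fun p => T p a)) ->
  (forall p, U p -> determinant (jacobian T p) <> 0) ->
  smooth_on U (fun p => inv_jacobian T p a b).
Proof.
move=> oU sT nz k; apply: Ck_invmx => // i j; exact: smooth_jacobian.
Qed.

Lemma near_identity_ball (I : finType) (U : (I -> R) -> Prop) (T : (I -> R) -> I -> R) p0 :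
  is_open U -> U p0 -> (forall a, smooth_on U (fun p => T p a)) ->
  (forall a c, pd (fun q => T q a) p0 c = delta a c) ->
  exists rho, [/\ 0 < rho, forall p, near_pt p0 p rho -> U p /\ determinant (jacobian T p) <> 0
    & near_identity (fun p => near_pt p0 p rho) T].
Proof.
move=> oU Up0 sT dT.
set n := \big[Rplus/0]_(a : I) 1.
have n0 : 0 <= n by apply: rsum_ge0 => _; lra.
(* [n] is the number of coordinates; a relative error of [1 / (2 * (n + 1))] in each adds up to at
   most 1/2. The added 1 covers an empty [I]. *)
have e0 : 0 < / (2 * (n + 1)) by apply: Rinv_0_lt_compat; lra.
have [d1 [d10 hd1]] : exists d, 0 < d /\ forall a q q', near_pt p0 q d -> near_pt p0 q' d ->
    Rabs (T q' a - T q a - (q' a - q a)) <= / (2 * (n + 1)) * \rsum_c Rabs (q' c - q c).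
  apply: (@fin_radius I (fun a d => forall q q', near_pt p0 q d -> near_pt p0 q' d ->
    Rabs (T q' a - T q a - (q' a - q a)) <= / (2 * (n + 1)) * \rsum_c Rabs (q' c - q c))).
    by move=> a d d' h [_ dd] q q' hq hq'; apply: h; [exact: near_le hq dd|exact: near_le hq' dd].
  move=> a; have [d [d0 hd]] := C1_differentiable oU (sT a 1%N) Up0 e0.
  exists d; split=> // q q' hq hq'; have [_] := hd q q' hq hq'.
  by under eq_bigr => c _ do rewrite dT; rewrite (rsum_delta (fun c => q' c - q c)).
have nz : determinant (jacobian T p0) <> 0.
  by apply: jacobian_kernel => v hv c; rewrite -(hv c) -[LHS](rsum_delta v); apply: eq_bigr => a _; rewrite dT.
(* While the determinant differs from its value at [p0] by less than the modulus of that value, it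
   cannot vanish. *)
have [|d2 [d20 hd2]] := (@Ck_det I 0%N U _ (jacobian T) oU (fun i j => smooth_jacobian i j oU sT 0%N))
  p0 Up0 (Rabs (determinant (jacobian T p0))); first exact: Rabs_pos_lt.
have [d3 [d30 hd3]] := oU _ Up0.
exists (Rmin d1 (Rmin d2 d3)); split.
- by do !apply: Rmin_pos.
- move=> p hp.
  have Up : U p by apply: hd3; apply: near_le hp _; apply: Rle_trans (Rmin_r _ _) (Rmin_r _ _).
  split=> // z; have := hd2 p Up _; rewrite z.
  rewrite Rabs_minus_sym Rminus_0_r => h.
  apply: (Rlt_irrefl (Rabs (determinant (jacobian T p0)))); apply: h.
  by apply: near_le hp _; apply: Rle_trans (Rmin_r _ _) (Rmin_l _ _).
- move=> q q' hq hq'.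
  have {}hq : near_pt p0 q d1 by apply: near_le hq _; exact: Rmin_l.
  have {}hq' : near_pt p0 q' d1 by apply: near_le hq' _; exact: Rmin_l.
  set D := \rsum_a Rabs (q' a - q a).
  have D0 : 0 <= D by apply: rsum_ge0 => a; exact: Rabs_pos.
  apply: (Rle_trans _ (n * (/ (2 * (n + 1)) * D))).
    by rewrite /n rsum_mulr; apply: rsum_le => a; rewrite Rmult_1_l; exact: hd1.
  rewrite -Rmult_assoc; apply: Rmult_le_compat_r => //.
  have -> : / 2 = (n + 1) * / (2 * (n + 1)) by field; lra.
  by apply: Rmult_le_compat_r; lra.
Qed.

(** The case normalised to identity derivative at [p0]. [W] is the image of a ball and [S] picks a
    preimage in it, with arbitrary values outside [W]; the expansion bound makes the preimage unique
    and [S] Lipschitz. *)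
Lemma inverse_function_id (I : finType) (U : (I -> R) -> Prop) (T : (I -> R) -> I -> R) p0 :
  is_open U -> U p0 -> (forall a, smooth_on U (fun p => T p a)) ->
  (forall a c, pd (fun q => T q a) p0 c = delta a c) ->
  exists (X W : (I -> R) -> Prop) (S : (I -> R) -> I -> R),
    [/\ is_open X, X p0, forall p, X p -> U p, is_open W & (forall a, smooth_on W (fun z => S z a))
     /\ forall p, X p -> W (T p) /\ S (T p) = p].
Proof.
move=> oU Up0 sT dT.
have [rho [rho0 hB nT]] := near_identity_ball oU Up0 sT dT.
pose B p := near_pt p0 p rho.
have oB : is_open B by exact: open_near.
have sTB a : smooth_on B (fun p => T p a).
  by move=> k; apply: Ck_sub (sT a k) => p /hB [].
pose W z := exists p, B p /\ T p = z.
pose S z := epsilon (inhabits p0) (fun p => B p /\ T p = z).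
have SP z : W z -> B (S z) /\ T (S z) = z by exact: epsilon_spec.
set n := \big[Rplus/0]_(a : I) 1.
have n0 : 0 <= n by apply: rsum_ge0 => _; lra.
(* The iteration is restarted at each [p1], in a ball of radius [e] inside [B]. The 4 absorbs the
   factor 2 in the condition on [z] and keeps the inequality strict. *)
have oW : is_open W.
  move=> _ [p1 [/oB [e [e0 he]] <-]].
  exists (e / (4 * (n + 1))); split; first by apply: Rdiv_lt_0_compat; lra.
  move=> z hz; have [| | |p [hp Tp]] := @near_identity_onto I T p1 z e.
  - by move=> q q' /he Bq /he Bq'; exact: nT.
  - by move=> a; apply: (@Ck_sub I 0%N _ _ _ _ (sTB a 0%N)) => q /he.
  - have := rsum_near hz; rewrite -/n => h.
    have : n * (e / (4 * (n + 1))) <= e / 4.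
      have -> : e / 4 = (n + 1) * (e / (4 * (n + 1))) by field; lra.
      by apply: Rmult_le_compat_r; [apply/Rlt_le/Rdiv_lt_0_compat; lra|lra].
    lra.
  - by exists p; split=> //; exact: he.
have lip z z' : W z -> W z' -> \rsum_a Rabs (S z' a - S z a) <= 2 * \rsum_a Rabs (z' a - z a).
  move=> /SP [Bz Tz] /SP [Bz' Tz'].
  by have := near_identity_expand nT Bz Bz'; rewrite Tz Tz'.
have cS a : cont_on W (fun z => S z a).
  move=> z Wz e e0; exists (e / (4 * (n + 1))); split; first by apply: Rdiv_lt_0_compat; lra.
  move=> z' Wz' hz; apply: (near_rsum (p := S z) (q := S z')).
  apply: Rle_lt_trans (lip _ _ Wz Wz') _.
  have := rsum_near hz; rewrite -/n => h.
  have : n * (e / (4 * (n + 1))) <= e / 4.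
    have -> : e / 4 = (n + 1) * (e / (4 * (n + 1))) by field; lra.
    by apply: Rmult_le_compat_r; [apply/Rlt_le/Rdiv_lt_0_compat; lra|lra].
  lra.
(* Apply the inverse Jacobian [G] to the expansion of [T] at [p]: the linear part returns [q - p],
   and the increment of [T] is [h] in direction [c]. The remainder is at most
   [K * (eps / (2 * (K + 1))) * (2 * |h|)], the last 2 being the Lipschitz constant of [S]. *)
have dS a c z : W z -> is_derive (fun t => S (upd z c t) a) 0 (inv_jacobian T (S z) a c).
  move=> Wz; have [Bz Tz] := SP z Wz; have [_ nz] := hB _ Bz.
  set p := S z in Bz Tz nz *; set G := inv_jacobian T p a.
  apply/derive_eps => eps e0.
  set K := \rsum_b Rabs (G b).
  have K0 : 0 <= K by apply: rsum_ge0 => b; exact: Rabs_pos.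
  have e'0 : 0 < eps / (2 * (K + 1)) by apply: Rdiv_lt_0_compat; lra.
  have [d [d0 hd]] : exists d, 0 < d /\ forall b q, near_pt p q d ->
      Rabs (T q b - T p b - \rsum_e (pd (fun q => T q b) p e * (q e - p e))) <=
      eps / (2 * (K + 1)) * \rsum_e Rabs (q e - p e).
    apply: (@fin_radius I (fun b d => forall q, near_pt p q d ->
      Rabs (T q b - T p b - \rsum_e (pd (fun q => T q b) p e * (q e - p e))) <=
      eps / (2 * (K + 1)) * \rsum_e Rabs (q e - p e))).
      by move=> b x x' h [_ xx] q hq; apply: h; exact: near_le hq xx.
    move=> b; have [x [x0 hx]] := C1_differentiable oB (sTB b 1%N) Bz e'0.
    by exists x; split=> // q hq; have [] := hx p q (near_refl p x0) hq.
  have [d' hd'] := @open_upd _ _ _ c oW Wz.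
  exists (Rmin (d / 2) d'); split; first by apply: Rmin_pos; [lra|exact: cond_pos].
  move=> h hh; rewrite Rplus_0_l upd0 -/p.
  have Wh : W (upd z c h).
    apply: hd'; suff : Rabs (h - 0) < d' by [].
    by rewrite Rminus_0_r; apply: Rlt_le_trans hh (Rmin_r _ _).
  have [Bh Th] := SP _ Wh; set q := S (upd z c h) in Bh Th *.
  have dist : \rsum_e Rabs (q e - p e) <= 2 * Rabs h.
    apply: Rle_trans (lip _ _ Wz Wh) _; apply: Rmult_le_compat_l; first lra.
    rewrite (@rsum_single I _ c) => [|e ec]; last by rewrite upd_neq // Rminus_diag Rabs_R0.
    by rewrite upd_eq; apply: Req_le; congr Rabs; ring.
  have nq : near_pt p q d.
    apply: near_rsum; apply: Rle_lt_trans dist _; have := Rmin_l (d / 2) d'; lra.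
  have -> : q a - p a = \rsum_b (G b * \rsum_e (pd (fun q => T q b) p e * (q e - p e))).
    rewrite -[LHS](rsum_delta (fun e => q e - p e)).
    under eq_bigr => e _ do rewrite -(inv_jacobianP nz) rsum_mulr.
    rewrite exchange_big /=; apply: eq_bigr => b _; rewrite rsum_mull.
    by apply: eq_bigr => e _; rewrite /G; ring.
  have -> : G c * h = \rsum_b (G b * (T q b - T p b)).
    rewrite Th Tz (@rsum_single I _ c) => [|e ec]; last by rewrite upd_neq // Rminus_diag; ring.
    by rewrite upd_eq; ring.
  rewrite rsum_sub; apply: Rle_trans (Rabs_rsum _) _.
  apply: (Rle_trans _ (\rsum_b (Rabs (G b) * (eps / (2 * (K + 1)) * (2 * Rabs h))))).
    apply: rsum_le => b; rewrite -Rmult_minus_distr_l Rabs_mult Rabs_minus_sym.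
    apply: Rmult_le_compat_l; first exact: Rabs_pos.
    by apply: Rle_trans (hd b q nq) _; apply: Rmult_le_compat_l; lra.
  rewrite -rsum_mulr -/K.
  have -> : K * (eps / (2 * (K + 1)) * (2 * Rabs h)) = (K * (eps / (K + 1))) * Rabs h by field; lra.
  apply: Rmult_le_compat_r; first exact: Rabs_pos.
  have -> : eps = (K + 1) * (eps / (K + 1)) by field; lra.
  have -> : (K + 1) * (eps / (K + 1)) / (K + 1) = eps / (K + 1) by field; lra.
  by apply: Rmult_le_compat_r; [apply/Rlt_le/Rdiv_lt_0_compat; lra|lra].
exists B, W, S; split=> //; [exact: near_refl|by move=> p /hB []|split].
  move=> a k; elim: k a => [|k IH] a; first exact: cS.
  (* Bootstrapping: the partial derivatives of [S] are smooth functions of [S], so degree [k] of [S]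
     gives degree [k + 1]. *)
  apply: (@Ck_intro _ _ _ _ (fun c z => inv_jacobian T (S z) a c)) => // c.
    by move=> z; exact: dS.
  apply: (@Ck_comp I I k W B (fun p => inv_jacobian T p a c) S) => //.
    by move=> z /SP [].
  by apply: smooth_inv_jacobian => // p /hB [].
move=> p Bp; have Wp : W (T p) by exists p.
split=> //; have [BS TS] := SP _ Wp.
have h := near_identity_expand nT BS Bp; rewrite TS in h.
apply: functional_extensionality => a.
apply: cond_eq => e e0; rewrite Rabs_minus_sym; apply: (near_rsum (p := S (T p)) (q := p)).
apply: Rle_lt_trans h _; rewrite big1 => [|b _]; first lra.
by rewrite Rminus_diag Rabs_R0.
Qed.

Lemma Ck_linear (I J : finType) k (U : (I -> R) -> Prop) (K : J -> R) (F : (I -> R) -> J -> R) :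
  is_open U -> (forall b, Ck k U (fun p => F p b)) -> Ck k U (fun p => \rsum_b (K b * F p b)).
Proof.
move=> oU kF; apply: Ck_rsum => // b; apply: Ck_mult => //; exact: Ck_const.
Qed.

Lemma is_open_true (I : eqType) : is_open (fun _ : I -> R => True).
Proof. by move=> p _; exists 1; split; [lra|]. Qed.

(** Following [T] by the inverse [A] of its derivative at [p0] reduces to identity derivative; [A]
    is then absorbed into the inverse map. *)
Theorem inverse_function (I : finType) (U : (I -> R) -> Prop) (T : (I -> R) -> I -> R) p0 :
  is_open U -> U p0 -> (forall a, smooth_on U (fun p => T p a)) ->
  determinant (jacobian T p0) <> 0 ->
  exists (X W : (I -> R) -> Prop) (S : (I -> R) -> I -> R),
    [/\ is_open X, X p0, forall p, X p -> U p, is_open W & (forall a, smooth_on W (fun z => S z a))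
     /\ forall p, X p -> W (T p) /\ S (T p) = p].
Proof.
move=> oU Up0 sT nz.
pose K := inv_jacobian T p0.
pose A (z : I -> R) a := \rsum_b (K a b * z b).
have sA a k : Ck k (fun _ => True) (fun z => A z a).
  apply: Ck_linear; first exact: is_open_true.
  by move=> b; apply: Ck_proj; exact: is_open_true.
have [| | X [W [S [oX Xp0 XU oW [sS hS]]]]] := @inverse_function_id I U (fun p => A (T p)) p0 oU Up0.
- by move=> a k; apply: Ck_linear => // b; exact: sT.
- move=> a c; rewrite -(inv_jacobianP nz a c).
  apply: is_derive_unique.
  apply: (@derive_rsum I (fun b t => K a b * T (upd p0 c t) b)) => b.
  apply: is_derive_scal; exact: Ck_derive (sT b 1%N) Up0.
exists X, (fun z => True /\ W (A z)), (fun z => S (A z)); split=> //.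
  by apply: open_preim => //; [exact: is_open_true|move=> a; exact: (sA a 0%N)].
split; last by move=> p /hS [WT e]; split.
move=> a k; apply: Ck_comp (sS a k) => //.
- by apply: open_preim => //; [exact: is_open_true|move=> b; exact: (sA b 0%N)].
- by move=> z [].
- by move=> b; apply: Ck_sub (sA b k).
Qed.

(** * Iterated Lie derivatives of the output *)

(** Without a term for the input coordinates, this is the time derivative along trajectories only
    for [g] independent of the inputs, as is the case below order [r]. *)
Definition lie {S V : finType} (fld : ((S + V)%type -> R) -> S -> R)
    (g : ((S + V)%type -> R) -> R) (p : (S + V)%type -> R) : R :=
  \rsum_s (pd g p (inl s) * fld p s).

Definition out_deriv {S V : finType} (fld : ((S + V)%type -> R) -> S -> R) (n : nat) (s : S) :
  ((S + V)%type -> R) -> R := iter n (lie fld) (fun p => p (inl s)).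

(** Comparing any two points of [U] avoids the connectedness that a condition on partial derivatives
    would need. *)
Definition depends_upto {I : eqType} (ord : I -> nat) (U : (I -> R) -> Prop) (n : nat)
    (g : (I -> R) -> R) : Prop :=
  forall p q, U p -> U q -> (forall c, (ord c <= n)%N -> p c = q c) -> g p = g q.

Lemma upd_agree (I : eqType) (p q : I -> R) c c' t : p c' = q c' -> upd p c t c' = upd q c t c'.
Proof. by rewrite /upd => ->. Qed.

Lemma pd_depends0 (I : eqType) (ord : I -> nat) (U : (I -> R) -> Prop) n g p c :
  is_open U -> depends_upto ord U n g -> U p -> (n < ord c)%N -> pd g p c = 0.
Proof.
move=> oU dg Up nc; rewrite /pd (Derive_ext_loc _ (fun=> g p)); first exact: Derive_const.
apply: filter_imp (@open_upd _ _ _ c oU Up) => t Ut; apply: dg => // c' c'n.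
by rewrite upd_neq //; apply: contraTneq c'n => ->; rewrite -ltnNge.
Qed.

Lemma pd_depends (I : eqType) (ord : I -> nat) (U : (I -> R) -> Prop) n g c :
  is_open U -> depends_upto ord U n g -> depends_upto ord U n (fun p => pd g p c).
Proof.
move=> oU dg p q Up Uq pq; apply: Derive_ext_loc.
apply: filter_imp (filter_and _ _ (@open_upd _ _ _ c oU Up) (@open_upd _ _ _ c oU Uq)) => t [Upt Uqt].
by apply: dg => // c' /pq; exact: upd_agree.
Qed.

(** Partial derivatives of [g] above order [n] vanish, so only field components of order at most [n]
    occur, and these reach order [n + 1] at most. *)
Lemma lie_depends (S V : finType) (ord : (S + V)%type -> nat) U (fld : ((S + V)%type -> R) -> S -> R) n g :
  is_open U -> (forall s, depends_upto ord U (ord (inl s)).+1 (fun p => fld p s)) ->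
  depends_upto ord U n g -> depends_upto ord U n.+1 (lie fld g).
Proof.
move=> oU dfld dg p q Up Uq pq; apply: eq_bigr => s _.
case: (leqP (ord (inl s)) n) => [sn|ns].
  congr (_ * _); last first.
    by apply: dfld => // c hc; apply: pq; exact: leq_trans hc _.
  by apply: (@pd_depends _ ord U n g (inl s)) => // c hc; apply: pq; exact: leqW.
by rewrite !(pd_depends0 oU dg) //; ring.
Qed.

Lemma out_deriv_depends (S V : finType) (ord : (S + V)%type -> nat) U
    (fld : ((S + V)%type -> R) -> S -> R) n s :
  is_open U -> (forall s, depends_upto ord U (ord (inl s)).+1 (fun p => fld p s)) ->
  ord (inl s) = 0%N -> depends_upto ord U n (out_deriv fld n s).
Proof.
move=> oU dfld s0; elim: n => [|n IH]; last exact: lie_depends.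
by move=> p q _ _; apply; rewrite s0.
Qed.

Lemma smooth_out_deriv (S V : finType) U (fld : ((S + V)%type -> R) -> S -> R) n s :
  is_open U -> (forall s, smooth_on U (fun p => fld p s)) -> smooth_on U (out_deriv fld n s).
Proof.
move=> oU sf; elim: n => [|n IH] k; first exact: Ck_proj.
apply: Ck_rsum => // s'; apply: Ck_mult => //; [exact: smooth_pd IH k|exact: sf].
Qed.

(** In the product rule the second derivatives of [g] drop out: [pd g] also depends only on orders
    up to [n], and [c] lies above. *)
Lemma pd_lie (S V : finType) (ord : (S + V)%type -> nat) U
    (fld : ((S + V)%type -> R) -> S -> R) n g p c :
  is_open U -> (forall s, smooth_on U (fun p => fld p s)) -> smooth_on U g ->
  depends_upto ord U n g -> U p -> (n < ord c)%N ->
  pd (lie fld g) p c = \rsum_s (pd g p (inl s) * pd (fun q => fld q s) p c).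
Proof.
move=> oU sf sg dg Up nc; apply: is_derive_unique; apply: derive_rsum => s.
have := derive_mult (Ck_derive c (smooth_pd (inl s) sg 1%N) Up) (Ck_derive c (sf s 1%N) Up).
rewrite upd0 (@pd_depends0 _ ord U n (fun q => pd g q (inl s))) //; last exact: pd_depends.
by rewrite Rmult_0_l Rplus_0_l.
Qed.

(* [ord] grades the coordinates by derivative order, the inputs having the top order [r].  The
   hypothesis [solve] says that the field at order [n] determines the coordinates of order [n + 1]. *)
Lemma out_deriv_block (S V Y : finType) (ord : (S + V)%type -> nat) r U
    (fld : ((S + V)%type -> R) -> S -> R) (y0 : Y -> S) p0 :
  is_open U -> U p0 -> (forall s, smooth_on U (fun p => fld p s)) ->
  (forall s, depends_upto ord U (ord (inl s)).+1 (fun p => fld p s)) ->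
  (forall y, ord (inl (y0 y)) = 0%N) ->
  (forall c, ord c = 0%N -> exists y, c = inl (y0 y)) ->
  (forall v, ord (inr v) = r) ->
  (forall n (v : (S + V)%type -> R), (n < r)%N -> (forall c, ord c <> n.+1 -> v c = 0) ->
     (forall s, ord (inl s) = n -> \rsum_c (pd (fun q => fld q s) p0 c * v c) = 0) ->
     forall c, v c = 0) ->
  forall n (v : (S + V)%type -> R), (n <= r)%N -> (forall c, ord c <> n -> v c = 0) ->
    (forall y, \rsum_c (pd (out_deriv fld n (y0 y)) p0 c * v c) = 0) -> forall c, v c = 0.
Proof.
move=> oU Up0 sf df ord0 ord0' ordr solve; elim=> [|n IH] v nr sv hv.
  move=> c; case: (eqVneq (ord c) 0%N) => [/ord0' [y ->]|/eqP /sv //].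
  rewrite -(hv y) (@rsum_single _ _ (inl (y0 y))) => [|c' c'y].
    by rewrite /out_deriv /= pd_proj eqxx Rmult_1_l.
  by rewrite /out_deriv /= pd_proj eq_sym (negbTE c'y) Rmult_0_l.
apply: (solve n v) => // s0 s0n.
(* [w] is the image of [v] under the Jacobian of the field, cut down to order [n]. It is shown to
   lie in the kernel of the [n]-th block, so the induction hypothesis makes it zero, and [solve]
   then applies to [v]. *)
pose w (c : (S + V)%type) : R := if c is inl s then
  if ord c == n then \rsum_c' (pd (fun q => fld q s) p0 c' * v c') else 0 else 0.
suff : w (inl s0) = 0 by rewrite /w s0n eqxx.
apply: IH; first exact: ltnW.
  by move=> [s|b] hc //=; case: eqP.
move=> y; apply: etrans (hv y).
have dL := out_deriv_depends (n := n) oU df (ord0 y).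
transitivity (\rsum_s (pd (out_deriv fld n (y0 y)) p0 (inl s) *
    \rsum_c (pd (fun q => fld q s) p0 c * v c))).
  rewrite big_sumType /w /= [X in _ + X]big1 ?Rplus_0_r => [|b _]; last exact: Rmult_0_r.
  apply: eq_bigr => s _; case: eqP => sn //.
  (* The cut loses nothing: above order [n] the output derivative has zero partials, and below it
     the field does not see order [n + 1], where [v] lives. *)
  case: (ltngtP (ord (inl s)) n) sn => // sn _; last first.
    by rewrite (pd_depends0 oU dL) //; ring.
  rewrite big1 => [|c _]; first ring.
  case: (eqVneq (ord c) n.+1) => [cn|/eqP /sv ->]; last ring.
  by rewrite (pd_depends0 oU (df s)) ?cn //; ring.
under eq_bigr => s _ do rewrite rsum_mull.
rewrite exchange_big /=; apply: eq_bigr => c _.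
case: (eqVneq (ord c) n.+1) => [cn|/eqP /sv ->]; last first.
  by rewrite Rmult_0_r big1 // => s _; rewrite !Rmult_0_r.
rewrite (@pd_lie S V ord U fld n (out_deriv fld n (y0 y)) p0 c) ?cn //; last exact: smooth_out_deriv.
by rewrite rsum_mulr; apply: eq_bigr => s _; rewrite Rmult_assoc.
Qed.

(** Each step up to order [r] differentiates a function independent of the inputs, so the chain rule
    multiplies the derivatives of [u] by zero. *)
Lemma out_deriv_trajectory (S V : finType) (ord : (S + V)%type -> nat) r U X
    (F : (S -> R) -> (V -> R) -> S -> R) (fld : ((S + V)%type -> R) -> S -> R) s a b x u :
  (forall x u, fld (join x u) = F x u) ->
  is_open U -> (forall p, X p -> U p) -> (forall s, smooth_on U (fun p => fld p s)) ->
  (forall s, depends_upto ord U (ord (inl s)).+1 (fun p => fld p s)) ->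
  ord (inl s) = 0%N -> (forall v, ord (inr v) = r) ->
  trajectory_in F X a b x u ->
  forall n t, (n <= r)%N -> a < t < b ->
    Derive_n (fun t => x t s) n t = out_deriv fld n s (join (x t) (u t)).
Proof.
move=> fldE oU XU sf df s0 ordr [_ [_ [su traj]]]; elim=> [//|n IH] t nr tab.
have loct : locally t (fun t' => a < t' < b).
  have d0 : 0 < Rmin (t - a) (b - t) by apply: Rmin_pos; lra.
  exists (mkposreal _ d0) => t' ht'.
  have : Rabs (t' - t) < Rmin (t - a) (b - t) by exact: ht'.
  move/Rabs_def2; have := Rmin_l (t - a) (b - t); have := Rmin_r (t - a) (b - t); lra.
rewrite /= (Derive_ext_loc _ (fun t => out_deriv fld n s (join (x t) (u t)))); last first.
  by apply: filter_imp loct => t' ht'; apply: IH => //; exact: ltnW.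
apply: is_derive_unique.
have [Xt dx] := traj t tab.
pose dp (c : (S + V)%type) := match c with inl s => F (x t) (u t) s | inr v => Derive (fun t => u t v) t end.
have -> : lie fld (out_deriv fld n s) (join (x t) (u t)) =
  \rsum_c (pd (out_deriv fld n s) (join (x t) (u t)) c * dp c).
  rewrite big_sumType /= [X in _ + X]big1 ?Rplus_0_r => [|v _]; first by rewrite /lie fldE.
  by rewrite (pd_depends0 oU (out_deriv_depends (n := n) oU df s0)) ?ordr //; [ring|exact: XU].
apply: (@chain_curve _ U (out_deriv fld n s) (fun t => join (x t) (u t))) => //.
- exact: smooth_out_deriv.
- exact: XU.
- move=> [s'|v] /=; first exact: dx.
  by apply: Derive_correct; exact: (su v 1%N t tab).
Qed.

Theorem triangular_flat (S V Y : finType) (ord : (S + V)%type -> nat) (kappa : (S + V)%type -> Y) r U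
    (F : (S -> R) -> (V -> R) -> S -> R) (fld : ((S + V)%type -> R) -> S -> R) (y0 : Y -> S) p0 :
  (forall x u, fld (join x u) = F x u) ->
  is_open U -> U p0 -> (forall s, smooth_on U (fun p => fld p s)) ->
  (forall s, depends_upto ord U (ord (inl s)).+1 (fun p => fld p s)) ->
  (forall y, ord (inl (y0 y)) = 0%N) ->
  (forall c, ord c = 0%N -> exists y, c = inl (y0 y)) ->
  (forall v, ord (inr v) = r) -> (forall c, (ord c <= r)%N) ->
  (forall n y, (n <= r)%N -> exists c, ord c = n /\ kappa c = y) ->
  (forall n (v : (S + V)%type -> R), (n < r)%N -> (forall c, ord c <> n.+1 -> v c = 0) ->
     (forall s, ord (inl s) = n -> \rsum_c (pd (fun q => fld q s) p0 c * v c) = 0) ->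
     forall c, v c = 0) ->
  exists X, is_open X /\ X p0 /\
    diff_flat_on F X 0 (fun (p : (S + (V * 'I_1))%type -> R) y => p (inl (y0 y))).
Proof.
move=> fldE oU Up0 sf df ord0 ord0' ordr ordle onto solve.
(* Pairing the coordinate [c] with the derivative of order [ord c] of output [kappa c] makes the jet
   map a self-map of the coordinate space, with a square Jacobian. *)
pose T p c := out_deriv fld (ord c) (y0 (kappa c)) p.
have sT c : smooth_on U (fun p => T p c) by exact: smooth_out_deriv.
have nz : determinant (jacobian T p0) <> 0.
  apply: jacobian_kernel => v hv.
  (* In the rows of order [n], columns of lower order meet components already zero and columns of
     higher order have zero entries; only the block of order [n] remains. *)
  suff H n : forall c, (ord c < n)%N -> v c = 0 by move=> c; exact: (H (ord c).+1).
  elim: n => [//|n IH] c; rewrite ltnS leq_eqVlt => /orP[/eqP cn|]; last exact: IH.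
  have nr : (n <= r)%N by rewrite -cn.
  pose w c := if ord c == n then v c else 0.
  suff : w c = 0 by rewrite /w cn eqxx.
  apply: (out_deriv_block oU Up0 sf df ord0 ord0' ordr solve nr).
    by move=> c' h; rewrite /w; case: eqP.
  move=> y; have [a [an ay]] := onto n y nr.
  apply: etrans (hv a); apply: eq_bigr => c' _; rewrite /T an ay /w; case: eqP => // c'n.
  case: (ltngtP (ord c') n) c'n => // c'n _; first by rewrite IH.
  rewrite (pd_depends0 oU (out_deriv_depends (n := n) oU df (ord0 y))) //; ring.
have [X [W [Sinv [oX Xp0 XU oW [sS hS]]]]] := inverse_function oU Up0 sT nz.
exists X; split=> //; split=> //; split.
  by move=> y k; exact: (Ck_proj k (inl (y0 y)) (@is_open_true _)).
(* Extracts from a jet the entries that make up [T]; [inord] never takes its default value, as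
   [ord c <= r]. *)
pose rel (q : (Y * 'I_r.+1)%type -> R) (c : (S + V)%type) := q (kappa c, inord (ord c)).
have oW' : is_open (fun q => True /\ W (rel q)).
  apply: (open_preim (@is_open_true _) oW (g := rel)) => c; exact: cont_on_proj.
have sm c : smooth_on (fun q => True /\ W (rel q)) (fun q => Sinv (rel q) c).
  by move=> k; apply: Ck_comp (sS c k) => // [q []|j] //; exact: Ck_proj.
exists r, (fun q s => Sinv (rel q) (inl s)), (fun q v => Sinv (rel q) (inr v)), (fun q => True /\ W (rel q)).
split=> //; split=> //; split=> // a b x u traj t tab y.
have relE : rel (jet r y t) = T (join (x t) (u t)).
  apply: functional_extensionality => c; rewrite /rel /jet /T /= inordK ?ltnS //.
  exact: (out_deriv_trajectory fldE oU XU sf df (ord0 _) ordr traj).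
have [Xt _] := traj.2.2.2 t tab.
have [WT ST] := hS _ Xt.
by rewrite relE ST.
Qed.

(** * The coupled pure-feedback system *)

Definition order {N r : nat} {m : 'I_N -> nat} (c : (SI r m + UI m)%type) : nat :=
  match c with inl s => val (projT2 s).1 | inr _ => r end.

Definition subsystem {N r : nat} {m : 'I_N -> nat} (c : (SI r m + UI m)%type) : 'I_N :=
  match c with inl s => projT1 s | inr v => projT1 v end.

(** Each of the [r + 1] orders, the inputs included, is a copy of [UI m], which also indexes the
    flat output. *)
Definition component {N r : nat} {m : 'I_N -> nat} (c : (SI r m + UI m)%type) : UI m :=
  match c with inl s => existT _ (projT1 s) (projT2 s).2 | inr v => v end.

Definition upart {I J : eqType} (p : (I + J)%type -> R) : J -> R := fun b => p (inr b).

Definition coupled_field {N r : nat} {m : 'I_N -> nat}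
  (fbar : forall i : 'I_N, (LI r (m i) -> R) -> ('I_r * 'I_(m i))%type -> R)
  (Delta : (SI r m -> R) -> SI r m -> R) (p : (SI r m + UI m)%type -> R) : SI r m -> R :=
  joint_field fbar Delta (xpart p) (upart p).

Definition global {N r : nat} {m : 'I_N -> nat} (i : 'I_N) (c : LI r (m i)) : (SI r m + UI m)%type :=
  match c with
  | inl jk => inl (existT (fun i => ('I_r * 'I_(m i))%type) i jk)
  | inr k => inr (existT (fun i => 'I_(m i)) i k)
  end.

Lemma locE (N r : nat) (m : 'I_N -> nat) (p : (SI r m + UI m)%type -> R) i :
  loc (xpart p) (upart p) i = fun c => p (global c).
Proof. by apply: functional_extensionality => -[]. Qed.

Lemma global_inj (N r : nat) (m : 'I_N -> nat) (i : 'I_N) : injective (@global N r m i).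
Proof. by move=> [a|a] [b|b] //= [] /eqP; rewrite eq_Tagged /= => /eqP ->. Qed.

Lemma loc_upd (N r : nat) (m : 'I_N -> nat) (p : (SI r m + UI m)%type -> R) i (c : LI r (m i)) t :
  loc (xpart (upd p (global c) t)) (upart (upd p (global c) t)) i =
  upd (loc (xpart p) (upart p) i) c t.
Proof.
rewrite !locE; apply: functional_extensionality => d; rewrite /upd.
by rewrite (inj_eq (@global_inj N r m i)).
Qed.

Lemma Delta_depends (N r : nat) (m : 'I_N -> nat) (Delta : (SI r m -> R) -> SI r m -> R) X s p q :
  lower_triangular_on Delta X -> X p -> X q ->
  (forall c, (order c <= order (inl s))%N -> p c = q c) ->
  (forall c, order c = (order (inl s)).+1 -> (subsystem c < subsystem (inl s))%N -> p c = q c) ->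
  Delta (xpart p) s = Delta (xpart q) s.
Proof.
move=> [_ /(_ s) [D hD]] Xp Xq h1 h2; rewrite !hD //; congr D.
apply: functional_extensionality => s'; rewrite /Defs.mask.
case: (excluded_middle_informative (lt_coords s s')) => [lc|//].
case: lc => [h|[h h']]; first exact: (h1 (inl s') h).
exact: (h2 (inl s') h h').
Qed.

(** At the last order nothing is restricted: all local coordinates, inputs included, have order at
    most [r = j + 1]. *)
Lemma fbar_depends (N r : nat) (m : 'I_N -> nat)
    (fbar : forall i : 'I_N, (LI r (m i) -> R) -> ('I_r * 'I_(m i))%type -> R)
    (p q : (SI r m + UI m)%type -> R) i (jk : ('I_r * 'I_(m i))%type) :
  pure_feedback fbar ->
  (forall c, (order c <= jk.1.+1)%N -> subsystem c = i -> p c = q c) ->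
  fbar i (loc (xpart p) (upart p) i) jk = fbar i (loc (xpart q) (upart q) i) jk.
Proof.
case: jk => j k pf h /=; case: (ltnP j.+1 r) => jr.
  apply: (pf i j k _ _ jr) => j' k' j'j; exact: (h (global (inl (j', k')))).
congr (fbar i _ _); rewrite !locE; apply: functional_extensionality => -[[j' k']|k'] /=;
  apply: h => //=.
by apply: leq_trans jr; exact: ltnW.
Qed.

Lemma coupled_field_depends (N r : nat) (m : 'I_N -> nat)
    (fbar : forall i : 'I_N, (LI r (m i) -> R) -> ('I_r * 'I_(m i))%type -> R)
    (Delta : (SI r m -> R) -> SI r m -> R) X s p q :
  pure_feedback fbar -> lower_triangular_on Delta X -> X p -> X q ->
  (forall c, (order c <= order (inl s))%N -> p c = q c) ->
  (forall c, order c = (order (inl s)).+1 -> (subsystem c <= subsystem (inl s))%N -> p c = q c) ->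
  coupled_field fbar Delta p s = coupled_field fbar Delta q s.
Proof.
move=> pf lt Xp Xq h1 h2; rewrite /coupled_field /joint_field; congr (_ + _); last first.
  by apply: Delta_depends lt Xp Xq h1 _ => c hc /ltnW; exact: h2.
case: s h1 h2 => i jk h1 h2; apply: fbar_depends => // c.
rewrite leq_eqVlt => /orP[/eqP cj|]; last by rewrite ltnS => /h1.
by move=> ci; apply: h2 => //; rewrite ci.
Qed.

(** Each component of [fbar] has its own neighbourhood in local coordinates; these are pulled back
    to the joint space and, being finitely many, intersected with [X0]. *)
Lemma coupled_field_smooth (N r : nat) (m : 'I_N -> nat)
    (fbar : forall i : 'I_N, (LI r (m i) -> R) -> ('I_r * 'I_(m i))%type -> R)
    (Delta : (SI r m -> R) -> SI r m -> R) (xs : SI r m -> R) (us : UI m -> R) X0 :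
  regular_at fbar xs us -> is_open X0 -> X0 (join xs us) -> lower_triangular_on Delta X0 ->
  exists U, [/\ is_open U, U (join xs us), forall p, U p -> X0 p
    & forall s, smooth_on U (fun p => coupled_field fbar Delta p s)].
Proof.
move=> [reg _] oX0 X0p [sD _].
have reg' (s : SI r m) : exists U, is_open U /\ U (join xs us) /\
    smooth_on U (fun p => fbar (projT1 s) (loc (xpart p) (upart p) (projT1 s)) (projT2 s)).
  have [U [oU [Up sU]]] := reg (projT1 s) (projT2 s).
  have oV : is_open (fun p : (SI r m + UI m)%type -> R => True /\ U (loc (xpart p) (upart p) (projT1 s))).
    apply: (open_preim (@is_open_true _) oU (g := fun p => loc (xpart p) (upart p) (projT1 s))).
    by move=> [jk|k]; exact: cont_on_proj.
  exists (fun p => True /\ U (loc (xpart p) (upart p) (projT1 s))); split=> //; split=> //.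
  move=> k; apply: (@Ck_comp _ _ k _ U (fun q => fbar (projT1 s) q (projT2 s))
     (fun p => loc (xpart p) (upart p) (projT1 s))) => //.
  - by move=> p [].
  - by move=> [jk|l]; exact: Ck_proj.
pose Us s := proj1_sig (constructive_indefinite_description _ (reg' s)).
have hUs s := proj2_sig (constructive_indefinite_description _ (reg' s)).
rewrite -/(Us _) in hUs.
exists (fun p => X0 p /\ forall s, Us s p); split.
- by apply: is_open_and => //; apply: open_all => s; have [] := hUs s.
- by split=> // s; have [_ []] := hUs s.
- by move=> p [].
- move=> s k; apply: Ck_plus.
  + by apply: is_open_and => //; apply: open_all => s'; have [] := hUs s'.
  + have [_ [_ sU]] := hUs s; case: s sU => i jk sU.
    by apply: Ck_sub (sU k) => p [_]; exact.
  + by apply: Ck_sub (sD s k) => p [].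
Qed.

(** At the next order the coupling sees only strictly smaller subsystems, so it is constant along a
    coordinate of its own subsystem. *)
Lemma pd_coupled_field (N r : nat) (m : 'I_N -> nat)
    (fbar : forall i : 'I_N, (LI r (m i) -> R) -> ('I_r * 'I_(m i))%type -> R)
    (Delta : (SI r m -> R) -> SI r m -> R) (xs : SI r m -> R) (us : UI m -> R) X0
    i (jk : ('I_r * 'I_(m i))%type) (c : LI r (m i)) :
  regular_at fbar xs us -> is_open X0 -> X0 (join xs us) -> lower_triangular_on Delta X0 ->
  order (global c) = jk.1.+1 ->
  pd (fun p => coupled_field fbar Delta p (existT _ i jk)) (join xs us) (global c) =
  pd (fun p => fbar i p jk) (loc xs us i) c.
Proof.
move=> [reg _] oX0 X0p lt oc.
have [U [oU [Up sU]]] := reg i jk.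
have dU := Ck_derive c (sU 1%N) Up.
apply: is_derive_unique.
apply: (is_derive_ext_loc (fun t => fbar i (upd (loc xs us i) c t) jk + Delta xs (existT _ i jk))).
  apply: filter_imp (@open_upd _ _ _ (global c) oX0 X0p) => t Xt.
  rewrite /coupled_field /joint_field loc_upd; congr (_ + _).
  have neq c' : c' != global c -> upd (join xs us) (global c) t c' = join xs us c' by exact: upd_neq.
  apply: (Delta_depends (p := join xs us) lt X0p Xt) => c'.
    move=> hc; rewrite neq //; apply: contraTneq hc => ->.
    by rewrite oc -ltnNge.
  move=> _ hc; rewrite neq //; apply: contraTneq hc => ->.
  by case: c {dU oc Xt neq} => [?|?] /=; rewrite ltnn.
rewrite -[X in is_derive _ _ X]Rplus_0_r.
by apply: is_derive_plus dU _; exact: is_derive_const.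
Qed.

Lemma det_kernel n (M : 'M[R]_n) (v : 'I_n -> R) :
  determinant M <> 0 -> (forall k, \rsum_l (M k l * v l) = 0) -> forall l, v l = 0.
Proof.
move=> /eqP nz h l; apply/eqP; case: eqP => // vl.
case/negP: nz; rewrite -det_tr; apply/det0P; exists (\row_j v j)%R.
  by apply/eqP => /rowP /(_ l); rewrite !mxE.
apply/rowP => k; rewrite [LHS]mxE [RHS]mxE; apply: etrans (h k).
by apply: eq_bigr => j _; rewrite !mxE; exact: Rmult_comm.
Qed.

(** Forward substitution: in the equations of subsystem [i], smaller indices contribute zero by
    induction, larger ones do not enter, and the diagonal block is invertible. *)
Lemma coupled_field_solve (N r : nat) (m : 'I_N -> nat)
    (fbar : forall i : 'I_N, (LI r (m i) -> R) -> ('I_r * 'I_(m i))%type -> R)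
    (Delta : (SI r m -> R) -> SI r m -> R) (xs : SI r m -> R) (us : UI m -> R) X0 :
  pure_feedback fbar -> regular_at fbar xs us ->
  is_open X0 -> X0 (join xs us) -> lower_triangular_on Delta X0 ->
  forall n (v : (SI r m + UI m)%type -> R), (n < r)%N -> (forall c, order c <> n.+1 -> v c = 0) ->
  (forall s, order (inl s) = n ->
     \rsum_c (pd (fun q => coupled_field fbar Delta q s) (join xs us) c * v c) = 0) ->
  forall c, v c = 0.
Proof.
move=> pf reg oX0 X0p lt n v nr sv hv.
suff H k : forall c, (subsystem c < k)%N -> v c = 0 by move=> c; exact: (H (subsystem c).+1).
elim: k => [//|k IH] c; rewrite ltnS leq_eqVlt => /orP[/eqP ck|]; last exact: IH.
case: (eqVneq (order c) n.+1) => [cn|/eqP]; last exact: sv.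
have [i ci] : exists i, subsystem c = i by exists (subsystem c).
move: ck; rewrite ci => ik.
(* [h] lists the coordinates of order [n + 1] in subsystem [i]: substates if [n + 1 < r], inputs if
   [n + 1 = r]. Both regularity conditions thus take one form. *)
have [h [hinj hord hcod hdet]] : exists h : 'I_(m i) -> LI r (m i),
  [/\ injective h, forall l, order (global (h l)) = n.+1,
      forall c, order c = n.+1 -> subsystem c = i -> exists l, c = global (h l)
    & determinant (\matrix_(k, l) pd (fun p => fbar i p (Ordinal nr, k)) (loc xs us i) (h l)) <> 0].
  case: reg => _ [reg1 reg2]; case: (ltnP n.+1 r) => nr1.
    exists (fun l => inl (Ordinal nr1, l)); split=> [? ? []| | |] //; last exact: reg1.
    move=> [[i' [j l]]|[i' l]] /= e ei; last by exfalso; have := nr1; rewrite -e ltnn.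
    by subst i'; exists l; have -> : j = Ordinal nr1 by exact: val_inj.
  have rn : r = n.+1 by apply/eqP; rewrite eqn_leq nr1 nr.
  exists inr; split=> [? ? []| | |] //; last exact: reg2.
  move=> [[i' [j l]]|[i' l]] /= e ei; last by subst i'; exists l.
  by exfalso; have := ltn_ord j; rewrite e rn ltnn.
have [l ->] := hcod c cn ci.
apply: (det_kernel (v := fun l => v (global (h l))) hdet) => {}k'.
apply: etrans (hv (existT _ i (Ordinal nr, k')) erefl).
rewrite (@rsum_image _ _ (fun l => global (h l))).
- apply: eq_bigr => l' _; rewrite mxE (pd_coupled_field _ oX0 X0p lt) //.
- by move=> ? ? /global_inj /hinj.
move=> c' hc'; case: (eqVneq (order c') n.+1) => [c'n|/eqP /sv ->]; last exact: Rmult_0_r.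
case: (ltngtP (subsystem c') i) => [ci'|ic'|/val_inj /(hcod _ c'n) [l' /hc' //]].
  by rewrite IH ?Rmult_0_r // -ik.
rewrite /pd (Derive_ext_loc _ (fun=> coupled_field fbar Delta (join xs us) (existT _ i (Ordinal nr, k')))).
  by rewrite Derive_const Rmult_0_l.
apply: filter_imp (@open_upd _ _ _ c' oX0 X0p) => t Xt.
apply: (coupled_field_depends pf lt Xt X0p) => [c'' hc''|c'' _ hc'']; rewrite upd_neq //;
  apply: contraTneq hc'' => ->; last by rewrite -ltnNge.
by rewrite c'n /= -ltnNge.
Qed.

Theorem theorem1 (N r : nat) (hN : (1 <= N)%N) (hr : (0 < r)%N)
  (m : 'I_N -> nat)
  (fbar : forall i : 'I_N, (LI r (m i) -> R) -> ('I_r * 'I_(m i))%type -> R)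
  (Delta : (SI r m -> R) -> SI r m -> R)
  (xs : SI r m -> R) (us : UI m -> R) :
  pure_feedback fbar ->
  regular_at fbar xs us ->
  (exists X0 : ((SI r m + UI m)%type -> R) -> Prop,
      is_open X0 /\ X0 (join xs us) /\ lower_triangular_on Delta X0) ->
  exists X : ((SI r m + UI m)%type -> R) -> Prop,
    is_open X /\ X (join xs us) /\
    diff_flat_on (joint_field fbar Delta) X 0 (first_substates hr).
Proof.
move=> pf reg [X0 [oX0 [X0p lt]]].
have [U [oU Up UX0 sU]] := coupled_field_smooth reg oX0 X0p lt.
pose y0 (y : UI m) : SI r m := existT _ (projT1 y) (Ordinal hr, projT2 y).
apply: (@triangular_flat (SI r m) (UI m) (UI m) order component r U (joint_field fbar Delta)
  (coupled_field fbar Delta) y0 (join xs us)) => //.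
(* The grading uses only the order; the finer restriction by subsystem index serves in
   [coupled_field_solve]. *)
- move=> s p q /UX0 Xp /UX0 Xq h.
  by apply: (coupled_field_depends pf lt Xp Xq) => c; [move/leqW|move=> e _]; apply: h; rewrite ?e.
- move=> [[i [j k]]|v] /= e; last by exfalso; have := hr; rewrite e.
  by exists (existT _ i k); have -> : j = Ordinal hr by exact: val_inj.
- by move=> [[i [j k]]|v] //=; exact: ltnW.
- move=> n [i k]; rewrite leq_eqVlt => /orP[/eqP ->|nr]; first by exists (inr (existT _ i k)).
  by exists (inl (existT _ i (Ordinal nr, k))).
- exact: coupled_field_solve pf reg oX0 X0p lt.
Qed.
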